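(* Let $\Gamma=\mathbb{Z}_2\wr\mathbb{Z}$ be the lamplighter group. Let $n\ge 0$ be an integer. For $0\le l\le n$ let $$p_l(x)=a_{0,l}+a_{1,l}x+\cdots+a_{m_l,l}x^{m_l}$$ be a polynomial of degree $m_l\ge 1$ with non-negative integer coefficients, and assume $a_{1,0}\ge 1$. Let $d_1,\dots,d_n\ge 2$ be natural numbers. Then there exist an integer $k_0\ge1$, a matrix $A\in M_{k_0}(\mathcal{A}_{1/2})\subseteq M_{k_0}(\mathbb{Q}\Gamma)$ (where $\mathcal{A}_{1/2}$ is the $*$-subalgebra of $\mathbb{Q}\Gamma$ defined in the context) and non-zero rational numbers $q_0,q_1$ such that $$b^{(2)}(A)=q_0+q_1\sum_{k\ge 1}\frac{1}{2^{\,p_0(k)+p_1(k)d_1^k+\cdots+p_n(k)d_n^k}}\in\mathcal{C}(\Gamma,\mathbb{Q}).$$ If moreover $a_{0,0}=0$, then $$\sum_{k\ge 1}\frac{1}{2^{\,p_0(k)+p_1(k)d_1^k+\cdots+p_n(k)d_n^k}}\in\mathcal{G}(\Gamma,\mathbb{Q}).$$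
   Context: The lamplighter group is $\Gamma=\big(\bigoplus_{i\in\mathbb{Z}}\mathbb{Z}_2\big)\rtimes\mathbb{Z}$, with $\mathbb Z$ acting by the Bernoulli shift; it has generators $t$ and $a_i$ ($i\in\mathbb{Z}$) with relations $a_i^2=1$, $a_ia_j=a_ja_i$, $ta_it^{-1}=a_{i-1}$. The group algebra $\mathbb{Q}\Gamma$ has the involution determined by $(q\gamma)^*=q\gamma^{-1}$ for $q\in\mathbb{Q}$, $\gamma\in\Gamma$. Put $e_i=\frac{1+a_i}{2}\in\mathbb{Q}\Gamma$. The algebra $\mathcal{A}_{1/2}$ is the unital $*$-subalgebra of $\mathbb{Q}\Gamma$ generated by the three partial isometries $e_{-1}e_0t$, $e_{-1}(1-e_0)t$ and $(1-e_{-1})e_0t$. For a countable discrete group $G$ and a subfield $K\subseteq\mathbb{C}$ closed under complex conjugation, let $KG$ act on $\ell^2(G)$ by left multiplication, so that $A\in M_k(KG)$ is a bounded operator on $\ell^2(G)^k$. The group von Neumann algebra $\mathcal{N}(G)$ is the weak closure of $\mathbb{C}G$ in the bounded operators on $\ell^2(G)$, with trace $\mathrm{tr}(S)=\langle S\xi_e,\xi_e\rangle$, where $\xi_e$ is the indicator function of the identity $e\in G$; on $M_k(\mathcal{N}(G))$ put $\mathrm{Tr}((S_{ij}))=\sum_{i=1}^k\mathrm{tr}(S_{ii})$. The $\ell^2$-Betti number of $A\in M_k(KG)$ is $b^{(2)}(A)=\mathrm{Tr}(p_A)$, where $p_A\in M_k(\mathcal{N}(G))$ is the orthogonal projection of $\ell^2(G)^k$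 onto $\ker A$. The set $\mathcal{C}(G,K)$ consists of all $b^{(2)}(A)$ with $A\in M_k(KG)$, $k\ge 1$, and $\mathcal{G}(G,K)$ is the subgroup of $(\mathbb{R},+)$ generated by $\mathcal{C}(G,K)$. When $n=0$ the exponent is just $p_0(k)$. *)

(* Defs.v *)
From HB Require Import structures.
From mathcomp Require Import all_boot all_order all_algebra finmap.
From mathcomp Require Import monalg.
From mathcomp Require Import all_classical all_reals all_analysis.
From mathcomp.real_closed Require Import complex.

Set Implicit Arguments.
Unset Strict Implicit.
Unset Printing Implicit Defensive.

Import Order.TTheory GRing.Theory Num.Theory.
Import numFieldNormedType.Exports.

Local Open Scope fset_scope.
Local Open Scope ring_scope.

(* The ring structure of [monalg] is not available here: it requires the
   monomials to form a monoid in which only 1 is invertible. *)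
Definition grpalg (G : groupType) : Type := {malg rat[G]}.

HB.instance Definition _ (G : groupType) := GRing.Lmodule.on (grpalg G).

Section GroupAlgebra.
Variable G : groupType.
Implicit Types (a b c : grpalg G) (x y : G).

Definition gaone : grpalg G := << 1%g >>.

Definition gamul a b : grpalg G :=
  \sum_(x <- msupp a) \sum_(y <- msupp b) << a@_x * b@_y *g (x * y)%g >>.

Lemma gamulr a b :
  gamul a b = \sum_(y <- msupp b) \sum_(x <- msupp a)
                << a@_x * b@_y *g (x * y)%g >>.
Proof. by rewrite /gamul exchange_big. Qed.

Lemma gamullw (d1 d2 : {fset G}) a b :
  msupp a `<=` d1 -> msupp b `<=` d2 ->
  gamul a b = \sum_(x <- d1) \sum_(y <- d2) << a@_x * b@_y *g (x * y)%g >>.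
Proof.
move=> le_d1 le_d2; rewrite /gamul (big_fset_incl _ le_d1) /=.
  apply/eq_bigr=> x _; apply/big_fset_incl => // y _ /mcoeff_outdom ->.
  by rewrite mulr0 monalgU0.
move=> x _ /mcoeff_outdom ax.
by rewrite big1 => // y _; rewrite ax mul0r monalgU0.
Qed.

Lemma gamulrw (d1 d2 : {fset G}) a b :
  msupp a `<=` d1 -> msupp b `<=` d2 ->
  gamul a b = \sum_(y <- d2) \sum_(x <- d1) << a@_x * b@_y *g (x * y)%g >>.
Proof. by move=> le1 le2; rewrite (gamullw le1 le2) exchange_big. Qed.

Lemma gamul0g : left_zero 0 gamul.
Proof. by move=> a; rewrite /gamul msupp0 big_seq_fset0. Qed.

Lemma gamulg0 : right_zero 0 gamul.
Proof. by move=> a; rewrite gamulr msupp0 big_seq_fset0. Qed.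

Lemma gamulUg (q : rat) x a :
  gamul << q *g x >> a = \sum_(y <- msupp a) << q * a@_y *g (x * y)%g >>.
Proof.
rewrite (gamullw msuppU_le (fsubset_refl _)) big_seq_fset1.
by apply/eq_bigr => y _; rewrite mcoeffUU.
Qed.

Lemma gamulgU (q : rat) x a :
  gamul a << q *g x >> = \sum_(y <- msupp a) << a@_y * q *g (y * x)%g >>.
Proof.
rewrite (gamulrw (fsubset_refl _) msuppU_le) big_seq_fset1.
by apply/eq_bigr=> y _; rewrite mcoeffUU.
Qed.

Lemma gamulUU (q r : rat) x y :
  gamul << q *g x >> << r *g y >> = << q * r *g (x * y)%g >>.
Proof. by rewrite (gamulrw msuppU_le msuppU_le) !big_seq_fset1 !mcoeffUU. Qed.

Lemma gamulEl a b :
  gamul a b = \sum_(x <- msupp a) gamul << a@_x *g x >> b.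
Proof. by apply/eq_bigr=> x _; rewrite gamulUg. Qed.

Lemma gamulEr a b :
  gamul a b = \sum_(y <- msupp b) gamul a << b@_y *g y >>.
Proof. by rewrite gamulr; apply/eq_bigr=> x _; rewrite gamulgU. Qed.

Lemma gamul1g : left_id gaone gamul.
Proof.
move=> a; rewrite gamulUg [RHS]monalgE.
by apply/eq_bigr=> x _; rewrite mul1r mul1g.
Qed.

Lemma gamulg1 : right_id gaone gamul.
Proof.
move=> a; rewrite gamulgU [RHS]monalgE.
by apply/eq_bigr=> x _; rewrite mulr1 mulg1.
Qed.

Lemma gamulDl : left_distributive gamul +%R.
Proof.
move=> a b c.
rewrite [in RHS](gamullw (fsubsetUl _ (msupp b)) (fsubset_refl _)).
rewrite [in RHS](gamullw (fsubsetUr (msupp a) _) (fsubset_refl _)).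
rewrite (gamullw (msuppD_le _ _) (fsubset_refl _)).
rewrite -big_split /=; apply/eq_bigr=> x _.
rewrite -big_split /=; apply/eq_bigr=> y _.
by rewrite mcoeffD mulrDl monalgUD.
Qed.

Lemma gamulDr : right_distributive gamul +%R.
Proof.
move=> c a b.
rewrite [in RHS](gamulrw (fsubset_refl _) (fsubsetUl _ (msupp b))).
rewrite [in RHS](gamulrw (fsubset_refl _) (fsubsetUr (msupp a) _)).
rewrite (gamulrw (fsubset_refl _) (msuppD_le _ _)).
rewrite -big_split /=; apply/eq_bigr => x _.
rewrite -big_split /=; apply/eq_bigr => y _.
by rewrite mcoeffD mulrDr monalgUD.
Qed.

Lemma gamulA : associative gamul.
Proof.
move=> a b c.
rewrite [RHS](big_morph (gamul^~ _) (fun _ _ => gamulDl _ _ _) (gamul0g _)).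
rewrite gamulEl; apply/eq_bigr=> x _.
rewrite [LHS](big_morph (gamul _) (fun _ _ => gamulDr _ _ _) (gamulg0 _)).
rewrite [RHS](big_morph (gamul^~ _) (fun _ _ => gamulDl _ _ _) (gamul0g _)).
apply/eq_bigr=> y _.
rewrite [LHS](big_morph (gamul _) (fun _ _ => gamulDr _ _ _) (gamulg0 _)).
by rewrite gamulEr; apply/eq_bigr=> z _; rewrite !gamulUU mulrA mulgA.
Qed.

Lemma gaone_neq0 : gaone != 0.
Proof. by apply/eqP/malgP=> /(_ 1%g) /eqP; rewrite !mcoeffsE oner_eq0. Qed.

HB.instance Definition _ := GRing.Zmodule_isNzRing.Build (grpalg G)
  gamulA gamul1g gamulg1 gamulDl gamulDr gaone_neq0.

Lemma gascaleAl (q : rat) a b : q *: (a * b) = (q *: a) * b.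
Proof.
rewrite [RHS](gamullw (msuppZ_le _ _) (fsubset_refl _)) scaler_sumr.
apply/eq_bigr => x _; rewrite scaler_sumr; apply/eq_bigr => y _.
apply/malgP => z; rewrite mcoeffZ !mcoeffU mcoeffZ mulrnAr.
by rewrite mulrA.
Qed.

HB.instance Definition _ :=
  GRing.Lmodule_isLalgebra.Build rat (grpalg G) gascaleAl.

Definition gabase x : grpalg G := << x >>.

(* (q g)^* = q g^-1; the coefficients are rational, hence real *)
Definition gastar a : grpalg G := \sum_(x <- msupp a) << a@_x *g x^-1%g >>.

Definition star_subalg (S : set (grpalg G)) : Prop :=
  [/\ S 1,
      forall (q : rat) a b, S a -> S b -> S (q *: a + b),
      forall a b, S a -> S b -> S (a * b)
    & forall a, S a -> S (gastar a)].

Definition star_subalg_gen (X : set (grpalg G)) : set (grpalg G) :=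
  smallest star_subalg X.

End GroupAlgebra.

Section L2.
Variable R : realType.
Implicit Types T : choiceType.
Local Open Scope classical_set_scope.
Local Notation C := (R[i]).

(* Sum of an absolutely summable family, as the difference of the sums of its
   positive and negative parts (cf. [esumB]). *)
Definition usum T (h : T -> R) : R :=
  let h' := EFin \o h in
  fine (\esum_(x in [set: T]) h'^\+%E x - \esum_(x in [set: T]) h'^\-%E x)%E.

Definition csum T (h : T -> C) : C :=
  (usum (fun x => complex.Re (h x)) +i* usum (fun x => complex.Im (h x)))%C.

Definition ell2 T (f : T -> C) : Prop :=
  (\esum_(x in [set: T]) (complex.Re `|f x| ^+ 2)%:E < +oo)%E.

Definition inner T (f g : T -> C) : C := csum (fun x => f x * (g x)^*).

Variable G : groupType.

Definition ell2v k : set ('I_k -> G -> C) := [set f | forall i, ell2 (f i)].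

Definition innerv k (f g : 'I_k -> G -> C) : C := \sum_(i < k) inner (f i) (g i).

(* left multiplication: (g . f) x = f (g^-1 x) for g in G *)
Definition lact (a : grpalg G) (f : G -> C) (x : G) : C :=
  \sum_(g <- msupp a) ratr (a@_g) * f (g^-1 * x)%g.

Definition mxact k (A : 'M[grpalg G]_k) (f : 'I_k -> G -> C) : 'I_k -> G -> C :=
  fun i x => \sum_(j < k) lact (A i j) (f j) x.

Definition mxker k (A : 'M[grpalg G]_k) : set ('I_k -> G -> C) :=
  [set f | ell2v f /\ forall i x, mxact A f i x = 0].

(* For a closed subspace W of l^2(G)^k and v in l^2(G)^k such a w exists and is
   unique, so the default value of [xget] is irrelevant. *)
Definition orth_proj k (W : set ('I_k -> G -> C)) (v : 'I_k -> G -> C) :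
    'I_k -> G -> C :=
  xget (fun _ _ => 0)
    [set w | W w /\ forall u, W u -> innerv (fun i x => v i x - w i x) u = 0].

Definition xi_e (x : G) : C := (x == 1%g)%:R.

Definition xi_at k (i : 'I_k) : 'I_k -> G -> C :=
  fun j x => if j == i then xi_e x else 0.

(* Tr (S_ij) = sum_i <S_ii xi_e, xi_e>, where S_ii xi_e is the i-th component
   of the image of the vector with xi_e in position i and 0 elsewhere *)
Definition vnTr k (S : ('I_k -> G -> C) -> 'I_k -> G -> C) : C :=
  \sum_(i < k) inner (S (xi_at i) i) xi_e.

(* The trace of a projection is real, so taking the real part only changes the
   type. *)
Definition l2betti k (A : 'M[grpalg G]_k) : R :=
  complex.Re (vnTr (orth_proj (mxker A))).

Definition l2betti_set : set R :=
  [set b | exists k : nat, exists A : 'M[grpalg G]_k,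
             (0 < k)%N /\ b = l2betti A].

Definition add_subgroup (H : set R) : Prop :=
  H 0 /\ forall x y, H x -> H y -> H (x - y).

Definition l2betti_group : set R := smallest add_subgroup l2betti_set.

End L2.

Arguments l2betti_set R G : clear implicits.
Arguments l2betti_group R G : clear implicits.
Arguments l2betti R {G k} A.

(* Lamp f m stands for f t^m; the group laws below are those of the semidirect
   product with t a_i t^-1 = a_(i-1). *)
Record lamplighter := Lamp { lamps : {malg 'Z_2[int]}; pos : int }.

Definition lamp_pair (g : lamplighter) := (lamps g, pos g).
Definition pair_lamp (p : {malg 'Z_2[int]} * int) := Lamp p.1 p.2.
Lemma lamp_pairK : cancel lamp_pair pair_lamp. Proof. by case. Qed.

HB.instance Definition _ := Choice.copy lamplighter (can_type lamp_pairK).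

(* the action of t^n, sending a_i to a_(i-n) *)
Definition lshiftn (n : int) (f : {malg 'Z_2[int]}) : {malg 'Z_2[int]} :=
  [malg i in [fset j - n | j in msupp f] => f@_(i + n)].

Lemma lshiftnE n f i : (lshiftn n f)@_i = f@_(i + n).
Proof.
rewrite mcoeffE; case: ifPn => // /negP h; apply/esym/mcoeff_outdom/negP => fi.
by apply: h; apply/imfsetP; exists (i + n) => //=; rewrite addrK.
Qed.

Definition lamp_mul (g h : lamplighter) : lamplighter :=
  Lamp (lamps g + lshiftn (pos g) (lamps h)) (pos g + pos h).
Definition lamp_one : lamplighter := Lamp 0 0.
Definition lamp_inv (g : lamplighter) : lamplighter :=
  Lamp (- lshiftn (- pos g) (lamps g)) (- pos g).

Lemma lamp_mulA : associative lamp_mul.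
Proof.
move=> [f m] [g n] [h p]; rewrite /lamp_mul /= !addrA; congr Lamp.
rewrite -addrA; congr (_ + _); apply/malgP => i.
by rewrite mcoeffD !lshiftnE mcoeffD lshiftnE addrA.
Qed.

Lemma lamp_mul1g : left_id lamp_one lamp_mul.
Proof.
move=> [f m]; rewrite /lamp_mul /= !add0r; congr Lamp.
by apply/malgP => i; rewrite lshiftnE addr0.
Qed.

Lemma lamp_mulg1 : right_id lamp_one lamp_mul.
Proof.
move=> [f m]; rewrite /lamp_mul /= addr0; congr Lamp.
by apply/malgP => i; rewrite mcoeffD lshiftnE mcoeff0 addr0.
Qed.

Lemma lamp_mulVg : left_inverse lamp_one lamp_inv lamp_mul.
Proof.
by move=> [f m]; rewrite /lamp_mul /lamp_inv /lamp_one /= !addNr.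
Qed.

Lemma lamp_mulgV : right_inverse lamp_one lamp_inv lamp_mul.
Proof.
move=> [f m]; rewrite /lamp_mul /lamp_inv /= subrr; congr Lamp.
apply/malgP => i.
by rewrite mcoeffD lshiftnE mcoeffN lshiftnE addrK subrr mcoeff0.
Qed.

HB.instance Definition _ := isMonoid.Build lamplighter
  lamp_mulA lamp_mul1g lamp_mulg1.
HB.instance Definition _ := hasInv.Build lamplighter lamp_inv.
HB.instance Definition _ := Monoid_isGroup.Build lamplighter
  lamp_mulVg lamp_mulgV.

Definition lamp_t : lamplighter := Lamp 0 1.
Definition lamp_a (i : int) : lamplighter := Lamp << i >> 0.

Lemma lamp_a_sq i : (lamp_a i * lamp_a i)%g = 1%g.
Proof.
apply: (congr1 (fun f => Lamp f _)); apply/malgP => j.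
rewrite mcoeffD lshiftnE addr0 -mcoeffD -monalgUD /=.
by rewrite (_ : 1 + 1 = 0 :> 'Z_2) ?monalgU0 //; apply/val_inj.
Qed.

Lemma lamp_aC i j : (lamp_a i * lamp_a j)%g = (lamp_a j * lamp_a i)%g.
Proof.
apply: (congr1 (fun f => Lamp f _)); apply/malgP => k.
by rewrite !mcoeffD !lshiftnE addr0 addrC.
Qed.

Lemma lamp_conj i : (lamp_t * lamp_a i * lamp_t^-1)%g = lamp_a (i - 1).
Proof.
apply: (congr1 (fun f => Lamp f _)); apply/malgP => k /=.
rewrite !mcoeffD mcoeff0 add0r !lshiftnE mcoeffN lshiftnE mcoeff0 oppr0 addr0.
by rewrite !mcoeffU -subr_eq.
Qed.

Definition lamp_e (i : int) : grpalg lamplighter :=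
  (2%:Q)^-1 *: (1 + gabase (lamp_a i)).

Definition algebra_half : set (grpalg lamplighter) :=
  let t := gabase lamp_t in
  let e0 := lamp_e 0 in
  let e1 := lamp_e (-1) in
  star_subalg_gen
    [set e1 * e0 * t; e1 * (1 - e0) * t; (1 - e1) * e0 * t]%classic.

(* p ord0 is p_0, while p (lift ord0 i) and d i are p_(i+1) and d_(i+1) *)
Definition exponent n (p : 'I_n.+1 -> {poly nat}) (d : 'I_n -> nat) (k : nat) :
    nat :=
  ((p ord0).[k] + \sum_(i < n) (p (lift ord0 i)).[k] * d i ^ k)%N.

Definition exponent_series (R : realType) n (p : 'I_n.+1 -> {poly nat})
    (d : 'I_n -> nat) : R :=
  limn (fun N : nat => \sum_(1 <= k < N) (2 ^+ exponent p d k)^-1 : R).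

(* Main.v *)
Require Import Defs.
From HB Require Import structures.
From mathcomp Require Import all_boot all_order all_algebra finmap.
From mathcomp Require Import monalg.
From mathcomp Require Import all_classical all_reals all_analysis.
From mathcomp.real_closed Require Import complex.
From mathcomp Require Import ring lra zify.

Set Implicit Arguments.
Unset Strict Implicit.
Unset Printing Implicit Defensive.

Import Order.TTheory GRing.Theory Num.Theory.
Import numFieldNormedType.Exports.

Local Open Scope ring_scope.

(** Let [t] act as the shift of the configurations [x : Z -> {0, 1}] and [e_i] as
    the projection onto the configurations with [x_i = 0]. The three generators
    of the algebra move from a letter of [x] to the next one, across every pair
    of adjacent letters except 11. So the line of letters is cut inside each 11
    into blocks: words that begin and end with 1 and do not contain 11. Over an
    occurrence of a block [w] of [l] letters the algebra acts by rational
    [l x l] matrices; the corresponding matrix units ([munit]) lie in the group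
    algebra, and since an occurrence prescribes [l + 2] letters, the diagonal
    ones have trace [2^-(l+2)]. Blocks cover almost every letter, that is, the sum
    of [l 2^-(l+2)] over all blocks is 1 ([block_mass_tail]).

    Consequently, for a matrix [A] over the algebra, the kernel is the orthogonal
    sum of its parts over the blocks, and its l2-Betti number is the sum over [w]
    of [2^-(l+2)] times the dimension of the kernel of the finite matrix [A_w].
    The analytic half of this is [l2betti_exhaustion]: the kernel projections of
    the finite parts have rational coefficients, they increase, and their traces
    converge to the l2-Betti number.

    Now let [A_w] express that vectors attached to the letters of [w] are obtained
    one from another by matrices depending on the letter read, start on a given
    line, and satisfy linear conditions at the last letter ([automaton_op]). Its
    kernel is a line if the automaton accepts [w] and 0 otherwise; two zero
    columns, added to make the matrix square, contribute 2 in total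
    ([automaton_l2betti]). Being a sum of products of polynomials and
    exponentials, the exponent [E k] satisfies a linear recurrence
    ([linear_recurrent_exponent]), so that such an automaton can compute [E k]
    while it reads [k] letters 0. It is arranged to accept exactly the words
    [1 0^k 1 0^m 1] with [m = E k + 1 - k] ([accepts_block]); the linear
    coefficient of [p_0] ensures [m >= 1]. Such a word has [E k + 4] letters, hence
    the l2-Betti number is [2 + 2^-6 S], where [S] is the given series. As 2 is the
    l2-Betti number of a zero matrix and [S = 64 (b - 2)] for [b = 2 + 2^-6 S], the
    second claim follows. *)

(** * Absolutely summable families *)

Section RealSums.
Variables (R : realType) (T : choiceType).
Implicit Types (h f g : T -> R).

Definition asum h := (\esum_(x in [set: T]) `|h x|%:E)%E.
Definition abs_summable h : Prop := (asum h < +oo)%E.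

Lemma asum_ge0 h : (0 <= asum h)%E.
Proof. by apply: esum_ge0 => x _; rewrite lee_fin. Qed.

Lemma abs_summable_fin h : abs_summable h -> asum h = (fine (asum h))%:E.
Proof. by move=> hs; rewrite fineK // ge0_fin_numE // asum_ge0. Qed.

Lemma le_abs_summable h g :
  (forall x, `|h x| <= g x) -> abs_summable g -> abs_summable h.
Proof.
move=> hg; apply: le_lt_trans; apply: le_esum => x _; rewrite lee_fin.
exact: le_trans (hg x) (ler_norm _).
Qed.

Lemma abs_summableD f g :
  abs_summable f -> abs_summable g -> abs_summable (fun x => f x + g x).
Proof.
move=> hf hg; have hf' : summable [set: T] (EFin \o f) by [].
have hg' : summable [set: T] (EFin \o g) by [].
apply: le_lt_trans (summableD hf' hg'); apply: le_esum => x _.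
exact: lexx.
Qed.

Lemma abs_summableN f : abs_summable f -> abs_summable (fun x => - f x).
Proof.
move=> hf; apply: le_lt_trans hf; apply: le_esum => x _.
by rewrite normrN.
Qed.

Lemma asumZ_le (c : R) f : 0 <= c -> (asum (fun x => (c * f x)%R) <= c%:E * asum f)%E.
Proof.
move=> c0; apply: ge_ereal_sup => _ [X [finX _] <-].
rewrite (eq_fsbigr (fun x => c%:E * `|f x|%:E)%E); last first.
  by move=> x _; rewrite normrM ger0_norm.
rewrite -ge0_mule_fsumr; last by move=> x; rewrite lee_fin.
rewrite lee_wpmul2l ?lee_fin //; apply: esum_ge; exists X => //; exact: lexx.
Qed.

Lemma ge0_usum h : (forall x, 0 <= h x) ->
  usum h = fine (\esum_(x in [set: T]) (h x)%:E)%E.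
Proof.
move=> h0; rewrite /usum [X in (_ - X)%E](_ : _ = 0%E); last first.
  apply: esum1 => x _; rewrite funenegE /=; apply/max_idPr.
  by rewrite lee_fin oppr_le0.
rewrite sube0; congr fine; apply: eq_esum => x _; rewrite funeposE /=.
by apply/max_idPl; rewrite lee_fin.
Qed.

(** A difference of nonnegative summable families may be summed without passing to
    positive and negative parts; additivity of [usum] comes down to this. *)
Lemma usumB_ge0 f g : abs_summable f -> abs_summable g ->
  (forall x, 0 <= f x) -> (forall x, 0 <= g x) ->
  usum (fun x => f x - g x) = fine (asum f) - fine (asum g).
Proof.
move=> hf hg f0 g0; rewrite /usum.
have -> : EFin \o (fun x => f x - g x) = ((EFin \o f) \- (EFin \o g))%E by [].
rewrite esumB //; last 2 first.
- by move=> x _; rewrite lee_fin.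
- by move=> x _; rewrite lee_fin.
have asumE u : (forall x, 0 <= u x) ->
    (\esum_(x in [set: T]) (EFin \o u) x)%E = asum u.
  by move=> u0; apply: eq_esum => x _; rewrite ger0_norm.
by rewrite !asumE // (abs_summable_fin hf) (abs_summable_fin hg).
Qed.

Definition ppart (h : T -> R) x := (`|h x| + h x) / 2.
Definition npart (h : T -> R) x := (`|h x| - h x) / 2.

Lemma ppart_ge0 h x : 0 <= ppart h x.
Proof. by rewrite /ppart; have := ler_norm (- h x); rewrite normrN; lra. Qed.
Lemma npart_ge0 h x : 0 <= npart h x.
Proof. by rewrite divr_ge0 // subr_ge0 ler_norm. Qed.
Lemma ppart_npart h x : h x = ppart h x - npart h x.
Proof. by rewrite /ppart /npart; field. Qed.

Lemma ppart_summable h : abs_summable h -> abs_summable (ppart h).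
Proof.
move=> hs; have hn : abs_summable (fun x => `|h x|).
  by rewrite /abs_summable /asum; under eq_esum do rewrite normr_id.
apply: le_abs_summable hn => x.
rewrite ger0_norm ?ppart_ge0 // /ppart.
by have := ler_norm (h x); lra.
Qed.

Lemma npart_summable h : abs_summable h -> abs_summable (npart h).
Proof.
move=> hs; have hn : abs_summable (fun x => `|h x|).
  by rewrite /abs_summable /asum; under eq_esum do rewrite normr_id.
apply: le_abs_summable hn => x.
rewrite ger0_norm ?npart_ge0 // /npart.
by have := ler_norm (- h x); rewrite normrN; lra.
Qed.

Lemma fine_asumD f g : abs_summable f -> abs_summable g ->
  (forall x, 0 <= f x) -> (forall x, 0 <= g x) ->
  fine (asum (fun x => f x + g x)) = fine (asum f) + fine (asum g).
Proof.
move=> hf hg f0 g0.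
rewrite -fineD ?ge0_fin_numE ?asum_ge0 //; congr fine.
rewrite /asum -esumD => [|x _|x _]; rewrite ?lee_fin //.
apply: eq_esum => x _; rewrite -EFinD; congr EFin.
by rewrite !ger0_norm ?addr_ge0.
Qed.

Lemma usumE h : abs_summable h ->
  usum h = fine (asum (ppart h)) - fine (asum (npart h)).
Proof.
move=> hs; have {1}-> : h = fun x => ppart h x - npart h x.
  by apply/funext => x; exact: ppart_npart.
by rewrite usumB_ge0 //; [exact: ppart_summable|exact: npart_summable|
  exact: ppart_ge0|exact: npart_ge0].
Qed.

Lemma usumD f g : abs_summable f -> abs_summable g ->
  usum (fun x => f x + g x) = usum f + usum g.
Proof.
move=> hf hg.
have -> : (fun x => f x + g x) =
    fun x => (ppart f x + ppart g x) - (npart f x + npart g x).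
  by apply/funext => x; rewrite {1}(ppart_npart f) {1}(ppart_npart g); ring.
have [fp fn] := (ppart_summable hf, npart_summable hf).
have [gp gn] := (ppart_summable hg, npart_summable hg).
rewrite usumB_ge0; [|exact: abs_summableD|exact: abs_summableD| |]; first last.
- by move=> x; rewrite addr_ge0 // npart_ge0.
- by move=> x; rewrite addr_ge0 // ppart_ge0.
rewrite (fine_asumD fp gp (ppart_ge0 f) (ppart_ge0 g)).
rewrite (fine_asumD fn gn (npart_ge0 f) (npart_ge0 g)).
by rewrite (usumE hf) (usumE hg); ring.
Qed.

Lemma usumN f : abs_summable f -> usum (fun x => - f x) = - usum f.
Proof.
move=> hf; rewrite (usumE hf) opprB.
have -> : (fun x => - f x) = fun x => npart f x - ppart f x.
  by apply/funext => x; rewrite {1}(ppart_npart f) opprB.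
by rewrite usumB_ge0 //; [exact: npart_summable|exact: ppart_summable|
  exact: npart_ge0|exact: ppart_ge0].
Qed.

Lemma usumB f g : abs_summable f -> abs_summable g ->
  usum (fun x => f x - g x) = usum f - usum g.
Proof.
by move=> hf hg; rewrite usumD //; [rewrite usumN|exact: abs_summableN].
Qed.

Lemma usum_norm_le f g : abs_summable g -> (forall x, `|f x| <= g x) ->
  `|usum f| <= fine (asum g).
Proof.
move=> hg fg; have hf := le_abs_summable fg hg.
have le_fine u : abs_summable u -> (forall x, `|u x| <= g x) ->
    fine (asum u) <= fine (asum g).
  move=> hu ug; rewrite fine_le ?ge0_fin_numE ?asum_ge0 //.
  apply: le_esum => x _; rewrite lee_fin.
  exact: le_trans (ug x) (ler_norm _).
have [fp fn] := (ppart_summable hf, npart_summable hf).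
have hfp : 0 <= fine (asum (ppart f)) <= fine (asum g).
  rewrite fine_ge0 ?asum_ge0 // le_fine // => x.
  rewrite ger0_norm ?ppart_ge0 //; apply: le_trans (fg x).
  by rewrite /ppart; have := ler_norm (f x); lra.
have hfn : 0 <= fine (asum (npart f)) <= fine (asum g).
  rewrite fine_ge0 ?asum_ge0 // le_fine // => x.
  rewrite ger0_norm ?npart_ge0 //; apply: le_trans (fg x).
  by rewrite /npart; have := ler_norm (- f x); rewrite normrN; lra.
rewrite (usumE hf) ler_norml; apply/andP; split; lra.
Qed.

Lemma eq0_usum h : abs_summable h -> (forall x, 0 <= h x) -> usum h = 0 ->
  forall x, h x = 0.
Proof.
move=> hs h0; rewrite ge0_usum // => s0 x.
have sE : (\esum_(x in [set: T]) (h x)%:E)%E = asum h.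
  by apply: eq_esum => y _; rewrite ger0_norm.
have : ((h x)%:E <= \esum_(x in [set: T]) (h x)%:E)%E.
  apply: esum_ge; exists [set x]%classic; first by split; [exact: finite_set1|].
  by rewrite fsbig_set1.
rewrite sE (abs_summable_fin hs) -sE s0 lee_fin => hx.
by apply/eqP; rewrite eq_le hx h0.
Qed.

Lemma asum_fin (s : seq T) h : uniq s -> (forall x, x \notin s -> h x = 0) ->
  asum h = (\sum_(x <- s) `|h x|)%:E.
Proof.
move=> us hs; rewrite /asum.
have -> : (\esum_(x in [set: T]) `|h x|%:E =
    \esum_(x in [set` s]) `|h x|%:E)%E.
  rewrite [RHS]esum_mkcond; apply: eq_esum => x _.
  by case: ifPn => // xs; rewrite hs ?normr0 //; apply: contra xs => /mem_set.
by rewrite esum_fset // -(fsbig_seq _ _ us) sumEFin.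
Qed.

Lemma fin_abs_summable (s : seq T) h :
  (forall x, x \notin s -> h x = 0) -> abs_summable h.
Proof.
move=> hs; rewrite /abs_summable (@asum_fin (undup s)) ?undup_uniq ?ltry //.
by move=> x; rewrite mem_undup; exact: hs.
Qed.

Lemma usum_fin (s : seq T) h : uniq s ->
  (forall x, x \notin s -> h x = 0) -> usum h = \sum_(x <- s) h x.
Proof.
move=> us hs; have hsum := fin_abs_summable hs.
rewrite usumE // !(asum_fin us) /=.
- rewrite -sumrB; apply: eq_bigr => x _.
  by rewrite (ger0_norm (ppart_ge0 _ _)) (ger0_norm (npart_ge0 _ _)) -ppart_npart.
- by move=> x /hs; rewrite /npart => ->; rewrite normr0 subr0 mul0r.
- by move=> x /hs; rewrite /ppart => ->; rewrite normr0 addr0 mul0r.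
Qed.

End RealSums.

(** * Square summable families *)

Section SquareSummable.
Variables (R : realType) (T : choiceType).
Local Notation C := R[i].
Implicit Types (f g u : T -> C).

Definition sqnorm (z : C) : R := complex.Re z ^+ 2 + complex.Im z ^+ 2.
Definition sqn f := fine (asum (fun x => sqnorm (f x))).

Lemma sqnorm_ge0 z : 0 <= sqnorm z.
Proof. by rewrite addr_ge0 ?sqr_ge0. Qed.

Lemma sqn_ge0 f : 0 <= sqn f.
Proof. by rewrite fine_ge0 // asum_ge0. Qed.

Lemma Re_norm_sq (z : C) : complex.Re `|z| ^+ 2 = sqnorm z.
Proof. by rewrite normc_def /= sqr_sqrtr ?sqnorm_ge0. Qed.

Lemma ell2P f : ell2 f <-> abs_summable (fun x => sqnorm (f x)).
Proof.
rewrite /ell2 /abs_summable /asum.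
suff -> : (\esum_(x in [set: T]) (complex.Re `|f x| ^+ 2)%:E =
  \esum_(x in [set: T]) `|sqnorm (f x)|%:E)%E by [].
apply: eq_esum => x _; congr EFin.
by rewrite (ger0_norm (sqnorm_ge0 _)); exact: Re_norm_sq.
Qed.

Lemma ell2B f g : ell2 f -> ell2 g -> ell2 (fun x => f x - g x).
Proof.
move=> /ell2P hf /ell2P hg; apply/ell2P.
apply: (le_abs_summable _ (abs_summableD (abs_summableD hf hf) (abs_summableD hg hg))).
move=> x; rewrite ger0_norm ?sqnorm_ge0 // /sqnorm.
case: (f x) (g x) => a b [c d] /=.
by have := (sqr_ge0 (a + c), sqr_ge0 (b + d)); case; nra.
Qed.

Lemma fin_ell2 (s : seq T) f : (forall x, x \notin s -> f x = 0) -> ell2 f.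
Proof.
move=> hs; apply/ell2P; apply: (@fin_abs_summable _ _ s) => x /hs ->.
by rewrite /sqnorm /= expr0n addr0.
Qed.

Lemma Re_mulJ (z w : C) : complex.Re (z * w^*) =
  complex.Re z * complex.Re w + complex.Im z * complex.Im w.
Proof. by case: z w => a b [c d] /=; ring. Qed.

Lemma Im_mulJ (z w : C) : complex.Im (z * w^*) =
  complex.Im z * complex.Re w - complex.Re z * complex.Im w.
Proof. by case: z w => a b [c d] /=; ring. Qed.

Lemma ReB (z w : C) : complex.Re (z - w) = complex.Re z - complex.Re w.
Proof. by case: z w => a b [c d]. Qed.

Lemma ImB (z w : C) : complex.Im (z - w) = complex.Im z - complex.Im w.
Proof. by case: z w => a b [c d]. Qed.

(** The weight [c] makes up for the square root of the Cauchy-Schwarz inequality: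
    when [z] is small, a large [c] makes both terms small. *)
Lemma Re_mulJ_le (c : R) z w : 0 < c ->
  `|complex.Re (z * w^*)| <= c * sqnorm z + c^-1 * sqnorm w.
Proof.
move=> c0; rewrite Re_mulJ /sqnorm; case: z w => a b [p q] /=.
have h (s t : R) : `|s * t| <= c * s ^+ 2 + c^-1 * t ^+ 2.
  have e : t = c * (c^-1 * t) by rewrite mulrA divff ?mul1r ?gt_eqF.
  set t' := c^-1 * t in e.
  have -> : c^-1 * t ^+ 2 = c * t' ^+ 2.
    by rewrite /t'; field; rewrite gt_eqF.
  rewrite e mulrCA normrM (gtr0_norm c0) -mulrDr ler_pM2l // ler_norml.
  by apply/andP; split; nra.
have := h a p; have := h b q; rewrite !ler_norml => /andP[? ?] /andP[? ?].
by apply/andP; split; lra.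
Qed.

Lemma Im_mulJ_le (c : R) z w : 0 < c ->
  `|complex.Im (z * w^*)| <= c * sqnorm z + c^-1 * sqnorm w.
Proof.
move=> c0; have := @Re_mulJ_le c (complex.Im z +i* - complex.Re z)%C w c0.
by rewrite Re_mulJ Im_mulJ /sqnorm /= sqrrN mulNr [_ ^+ 2 + complex.Re z ^+ 2]addrC.
Qed.

Lemma mulJ_bound_summable (c : R) f u : 0 < c -> ell2 f -> ell2 u ->
  (asum (fun x => c * sqnorm (f x) + c^-1 * sqnorm (u x))%R <=
     (c * sqn f + c^-1 * sqn u)%:E)%E.
Proof.
move=> c0 /ell2P hf /ell2P hu.
have cV0 : 0 <= c^-1 by rewrite invr_ge0 ltW.
rewrite EFinD !EFinM /sqn -!abs_summable_fin //.
apply: le_trans (leeD (asumZ_le _ (ltW c0)) (asumZ_le _ cV0)).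
rewrite /asum -esumD => [|x _|x _]; rewrite ?lee_fin //.
by apply: le_esum => x _; rewrite -EFinD lee_fin ler_normD.
Qed.

Lemma mulJ_summable f u : ell2 f -> ell2 u ->
  abs_summable (fun x => complex.Re (f x * (u x)^*)) /\
  abs_summable (fun x => complex.Im (f x * (u x)^*)).
Proof.
move=> hf hu; have hb := mulJ_bound_summable ltr01 hf hu.
have hs := le_lt_trans hb (ltry _).
split; apply: le_abs_summable hs => x; first exact: Re_mulJ_le ltr01.
exact: Im_mulJ_le ltr01.
Qed.

Lemma inner_le (c : R) f u : 0 < c -> ell2 f -> ell2 u ->
  `|complex.Re (inner f u)| <= c * sqn f + c^-1 * sqn u /\
  `|complex.Im (inner f u)| <= c * sqn f + c^-1 * sqn u.
Proof.
move=> c0 hf hu; have hb := mulJ_bound_summable c0 hf hu.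
have hs := le_lt_trans hb (ltry _).
have hb' : fine (asum (fun x => c * sqnorm (f x) + c^-1 * sqnorm (u x))) <=
    c * sqn f + c^-1 * sqn u by rewrite -lee_fin -abs_summable_fin.
rewrite /inner /csum /=; split; apply: le_trans hb'; apply: usum_norm_le => // x.
  exact: Re_mulJ_le.
exact: Im_mulJ_le.
Qed.

Lemma innerBl f g u : ell2 f -> ell2 g -> ell2 u ->
  inner (fun x => f x - g x) u = inner f u - inner g u.
Proof.
move=> hf hg hu.
have [rf jf] := mulJ_summable hf hu; have [rg jg] := mulJ_summable hg hu.
rewrite /inner /csum.
have -> : (fun x => complex.Re ((f x - g x) * (u x)^*)) =
    (fun x => complex.Re (f x * (u x)^*) - complex.Re (g x * (u x)^*)).
  by apply/funext => x; rewrite mulrBl ReB.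
have -> : (fun x => complex.Im ((f x - g x) * (u x)^*)) =
    (fun x => complex.Im (f x * (u x)^*) - complex.Im (g x * (u x)^*)).
  by apply/funext => x; rewrite mulrBl ImB.
by rewrite !usumB.
Qed.

Lemma inner_fin (s : seq T) f u : uniq s -> (forall x, x \notin s -> f x = 0) ->
  inner f u = \sum_(x <- s) f x * (u x)^*.
Proof.
move=> us hs; rewrite /inner /csum !(usum_fin us).
- elim: {us hs} s => [|x s IHs]; first by rewrite !big_nil.
  by rewrite !big_cons -IHs; case: (f x * _).
- by move=> x /hs ->; rewrite mul0r.
- by move=> x /hs ->; rewrite mul0r.
Qed.

Lemma Re_inner_self f : ell2 f -> complex.Re (inner f f) = sqn f.
Proof.
move=> hf; rewrite /inner /csum /=.
have -> : (fun x => complex.Re (f x * (f x)^*)) = fun x => sqnorm (f x).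
  by apply/funext => x; rewrite Re_mulJ /sqnorm !expr2.
rewrite ge0_usum; last by move=> x; exact: sqnorm_ge0.
by congr fine; apply: eq_esum => x _; rewrite ger0_norm ?sqnorm_ge0.
Qed.

Lemma sqn_eq0 f : ell2 f -> sqn f = 0 -> forall x, f x = 0.
Proof.
move=> hf f0 x; have /ell2P hs := hf.
have : sqnorm (f x) = 0.
  apply: (@eq0_usum _ _ (fun x => sqnorm (f x)) hs) => [y|].
    exact: sqnorm_ge0.
  rewrite ge0_usum; last by move=> y; exact: sqnorm_ge0.
  rewrite -[RHS]f0; congr fine; apply: eq_esum => y _.
  by rewrite ger0_norm ?sqnorm_ge0.
rewrite /sqnorm; case: (f x) => a b /= /eqP.
by rewrite paddr_eq0 ?sqr_ge0 // !sqrf_eq0 => /andP[/eqP-> /eqP->].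
Qed.

Lemma sqn_le f (c : R) : (forall s : seq T, uniq s ->
  \sum_(x <- s) sqnorm (f x) <= c) -> ell2 f /\ sqn f <= c.
Proof.
move=> hc.
have h : (asum (fun x => sqnorm (f x)) <= c%:E)%E.
  apply: ge_ereal_sup => _ [X [finX _] <-].
  rewrite fsbig_finite // sumEFin lee_fin.
  under eq_bigr do rewrite (ger0_norm (sqnorm_ge0 _)).
  exact: hc (fset_uniq _).
have hs : abs_summable (fun x => sqnorm (f x)) := le_lt_trans h (ltry _).
by split; [exact/ell2P|rewrite -lee_fin -abs_summable_fin].
Qed.

End SquareSummable.

(** * The group algebra and its action on l2 *)

Section GroupAlgebraTheory.
Variable G : groupType.
Implicit Types (a b c : grpalg G) (x y g : G).

Definition gcoef g a : rat := a@_g.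

Fact gcoef_is_additive g : additive (gcoef g).
Proof. by move=> a b; exact: mcoeffB. Qed.
HB.instance Definition _ g :=
  GRing.isZmodMorphism.Build (grpalg G) rat (gcoef g) (gcoef_is_additive g).

Lemma gcoefZ g q a : gcoef g (q *: a) = q * gcoef g a.
Proof. exact: mcoeffZ. Qed.

Lemma gcoefD g a b : gcoef g (a + b) = gcoef g a + gcoef g b.
Proof. exact: raddfD. Qed.

Lemma gcoefP a b : (forall g, gcoef g a = gcoef g b) -> a = b.
Proof. by move=> h; apply/malgP. Qed.

Definition gterm (q : rat) g : grpalg G := << q *g g >>.

Lemma gcoef_term q g h : gcoef h (gterm q g) = q *+ (g == h).
Proof. exact: mcoeffU. Qed.

Lemma gcoef1_one : gcoef 1%g 1 = 1.
Proof. by rewrite (gcoef_term 1 1%g) eqxx. Qed.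

Lemma grpalgE a : a = \sum_(g <- msupp a) gterm (gcoef g a) g.
Proof. exact: monalgE. Qed.

Lemma gtermZ q g : gterm q g = q *: gabase g.
Proof.
by apply: gcoefP => h; rewrite gcoefZ !gcoef_term mulr_natr.
Qed.

Lemma gterm_mul q r x y : gterm q x * gterm r y = gterm (q * r) (x * y)%g.
Proof. exact: gamulUU. Qed.

Lemma gabase_mul x y : gabase x * gabase y = gabase (x * y)%g.
Proof. by rewrite /gabase -!/(gterm 1 _) gterm_mul mulr1. Qed.

Lemma grpalg_ind (Q : grpalg G -> Prop) :
  Q 0 -> (forall a b, Q a -> Q b -> Q (a + b)) ->
  (forall q g, Q (gterm q g)) -> forall a, Q a.
Proof.
move=> Q0 QD QU a; rewrite (grpalgE a).
by elim/big_ind: _ => // *; exact: QU.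
Qed.

Lemma gascaleAr (q : rat) a b : q *: (a * b) = a * (q *: b).
Proof.
elim/grpalg_ind: a => [|a a' IHa IHa'|r x].
- by rewrite !mul0r scaler0.
- by rewrite !mulrDl scalerDr IHa IHa'.
elim/grpalg_ind: b => [|b b' IHb IHb'|s y].
- by rewrite scaler0 !mulr0 scaler0.
- by rewrite mulrDr !scalerDr IHb IHb' mulrDr.
have h u z : q *: gterm u z = gterm (q * u) z by rewrite !gtermZ scalerA.
by rewrite h !gterm_mul h mulrCA.
Qed.

HB.instance Definition _ :=
  GRing.Lalgebra_isAlgebra.Build rat (grpalg G) gascaleAr.

Lemma gcoef_termM q x a g : gcoef g (gterm q x * a) = q * gcoef (x^-1 * g)%g a.
Proof.
elim/grpalg_ind: a => [|a b IHa IHb|r y].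
- by rewrite mulr0 !raddf0 mulr0.
- by rewrite mulrDr !raddfD /= IHa IHb mulrDr.
rewrite gterm_mul !gcoef_term mulrnAr; congr (_ *+ nat_of_bool _).
by apply/eqP/eqP => [<-|->]; rewrite ?mulKg ?mulVKg.
Qed.

Lemma gcoef_mterm q x a g : gcoef g (a * gterm q x) = gcoef (g * x^-1)%g a * q.
Proof.
elim/grpalg_ind: a => [|a b IHa IHb|r y].
- by rewrite mul0r !raddf0 mul0r.
- by rewrite mulrDl !raddfD /= IHa IHb mulrDl.
rewrite gterm_mul !gcoef_term mulrnAl; congr (_ *+ nat_of_bool _).
by apply/eqP/eqP => [<-|->]; rewrite ?mulgK ?mulgVK.
Qed.

Lemma gastarE a : gastar a = \sum_(x <- msupp a) gterm (gcoef x a) x^-1%g.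
Proof. by []. Qed.

Lemma gcoef_star a g : gcoef g (gastar a) = gcoef g^-1%g a.
Proof.
rewrite gastarE raddf_sum [in RHS](grpalgE a) raddf_sum.
apply: eq_bigr => x _; rewrite /= !gcoef_term; congr (_ *+ nat_of_bool _).
by apply/eqP/eqP => [<-|->]; rewrite invgK.
Qed.

Fact gastar_is_additive : additive (@gastar G).
Proof. by move=> a b; apply: gcoefP => g; rewrite raddfB /= !gcoef_star raddfB. Qed.
HB.instance Definition _ := GRing.isZmodMorphism.Build
  (grpalg G) (grpalg G) (@gastar G) gastar_is_additive.

Lemma gastarD a b : gastar (a + b) = gastar a + gastar b.
Proof. exact: raddfD. Qed.

Lemma gastarZ q a : gastar (q *: a) = q *: gastar a.
Proof. by apply: gcoefP => g; rewrite gcoefZ !gcoef_star gcoefZ. Qed.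

Lemma gastarK : involutive (@gastar G).
Proof. by move=> a; apply: gcoefP => g; rewrite !gcoef_star invgK. Qed.

Lemma gastar_term q g : gastar (gterm q g) = gterm q g^-1%g.
Proof.
apply: gcoefP => h; rewrite gcoef_star !gcoef_term.
by congr (_ *+ nat_of_bool _); apply/eqP/eqP => [->|<-]; rewrite invgK.
Qed.

Lemma gastar_base g : gastar (gabase g) = gabase g^-1%g.
Proof. exact: gastar_term. Qed.

Lemma gastar1 : gastar 1 = 1 :> grpalg G.
Proof. by rewrite [LHS]gastar_base invg1. Qed.

Lemma gastarM a b : gastar (a * b) = gastar b * gastar a.
Proof.
elim/grpalg_ind: a => [|a a' IHa IHa'|q x].
- by rewrite !(mul0r, raddf0, mulr0).
- by rewrite mulrDl !raddfD /= IHa IHa' mulrDr.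
elim/grpalg_ind: b => [|b b' IHb IHb'|r y].
- by rewrite !(mul0r, raddf0, mulr0).
- by rewrite mulrDr !raddfD /= IHb IHb' mulrDl.
by rewrite !(gterm_mul, gastar_term) invgM mulrC.
Qed.

Lemma gtrace_starM a b :
  gcoef 1%g (gastar a * b) = \sum_(x <- msupp a) gcoef x a * gcoef x b.
Proof.
rewrite gastarE mulr_suml raddf_sum; apply: eq_bigr => x _.
by rewrite /= gcoef_termM invgK mulg1.
Qed.

(** The right-hand side is the sum of the squares of all coefficients of [a]. *)
Lemma sum_gcoef_sq_le (s : seq G) a : uniq s ->
  \sum_(x <- s) gcoef x a ^+ 2 <= gcoef 1%g (gastar a * a).
Proof.
move=> us; rewrite gtrace_starM.
under [leRHS]eq_bigr do rewrite -expr2.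
rewrite (bigID (fun x => x \in msupp a)) /= [X in _ + X]big1 ?addr0; last first.
  by move=> x /mcoeff_outdom; rewrite /gcoef => ->; rewrite expr0n.
rewrite [leRHS](bigID (fun x => x \in s)) /= -[leLHS]addr0.
apply: lerD; last by apply: sumr_ge0 => *; exact: sqr_ge0.
rewrite -big_filter -[leRHS]big_filter le_eqVlt; apply/orP; left; apply/eqP.
apply: perm_big; apply: uniq_perm; rewrite ?filter_uniq ?fset_uniq //.
by move=> x; rewrite !mem_filter andbC.
Qed.

Section Action.
Variable R : realType.
Implicit Types f : G -> R[i].

Lemma lact_wide (d : {fset G}) a f x : (msupp a `<=` d)%fset ->
  lact a f x = \sum_(g <- d) ratr (gcoef g a) * f (g^-1 * x)%g.
Proof.
move=> ad; rewrite /lact (big_fset_incl _ ad) //= => g _ /mcoeff_outdom ->.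
by rewrite rmorph0 mul0r.
Qed.

Lemma lactD a b f x : lact (a + b) f x = lact a f x + lact b f x.
Proof.
rewrite (lact_wide (d := msupp a `|` msupp b)%fset); last exact: msuppD_le.
rewrite (lact_wide f x (fsubsetUl (msupp a) (msupp b))).
rewrite (lact_wide f x (fsubsetUr (msupp a) (msupp b))).
by rewrite -big_split /=; apply: eq_bigr => g _; rewrite raddfD rmorphD mulrDl.
Qed.

Lemma lact_term q g f x : lact (gterm q g) f x = ratr q * f (g^-1 * x)%g.
Proof.
rewrite (lact_wide (d := [fset g]%fset)) ?msuppU_le // big_seq_fset1.
by rewrite gcoef_term eqxx.
Qed.

Lemma lact0 f x : lact 0 f x = 0.
Proof. by rewrite /lact msupp0 big_seq_fset0. Qed.

Lemma lactN a f x : lact (- a) f x = - lact a f x.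
Proof. by apply/eqP; rewrite -addr_eq0 -lactD addNr lact0. Qed.

Lemma lactB a b f x : lact (a - b) f x = lact a f x - lact b f x.
Proof. by rewrite lactD lactN. Qed.

Lemma lact_sumr I (r : seq I) a (F : I -> G -> R[i]) x :
  lact a (fun y => \sum_(i <- r) F i y) x = \sum_(i <- r) lact a (F i) x.
Proof.
rewrite /lact exchange_big; apply: eq_bigr => g _ /=.
by rewrite mulr_sumr.
Qed.

Lemma lact_suml I (r : seq I) (F : I -> grpalg G) f x :
  lact (\sum_(i <- r) F i) f x = \sum_(i <- r) lact (F i) f x.
Proof.
by apply: (big_morph (fun a => lact a f x)) => [a b|]; rewrite ?lactD ?lact0.
Qed.

Lemma lactM a b f x : lact (a * b) f x = lact a (lact b f) x.
Proof.
elim/grpalg_ind: a => [|a a' IHa IHa'|q g].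
- by rewrite mul0r !lact0.
- by rewrite mulrDl !lactD IHa IHa'.
rewrite lact_term.
elim/grpalg_ind: b => [|b b' IHb IHb'|r h].
- by rewrite mulr0 !lact0 mulr0.
- by rewrite mulrDr !lactD mulrDr IHb IHb'.
by rewrite gterm_mul !lact_term rmorphM invgM mulrA mulgA.
Qed.

Lemma lact_star1 a f :
  lact (gastar a) f 1%g = \sum_(x <- msupp a) ratr (gcoef x a) * f x.
Proof.
rewrite gastarE lact_suml; apply: eq_bigr => x _.
by rewrite lact_term invgK mulg1.
Qed.

Lemma lact_gcoef a b x :
  lact a (fun y => ratr (gcoef y b)) x = ratr (gcoef x (a * b)) :> R[i].
Proof.
elim/grpalg_ind: a => [|a a' IHa IHa'|q g].
- by rewrite mul0r lact0 raddf0 rmorph0.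
- by rewrite mulrDl lactD IHa IHa' raddfD rmorphD.
by rewrite lact_term gcoef_termM rmorphM.
Qed.

Variable k : nat.
Implicit Types (A B : 'M[grpalg G]_k) (v : 'I_k -> G -> R[i]).

Lemma mxactM A B v i x : mxact (A *m B) v i x = mxact A (mxact B v) i x.
Proof.
rewrite /mxact; under eq_bigr => j _ do rewrite mxE lact_suml.
under [RHS]eq_bigr => j _ do rewrite lact_sumr.
rewrite exchange_big; apply: eq_bigr => j _; apply: eq_bigr => l _.
exact: lactM.
Qed.

Lemma mxactB A B v i x : mxact (A - B) v i x = mxact A v i x - mxact B v i x.
Proof.
rewrite /mxact -sumrB; apply: eq_bigr => j _.
by rewrite !mxE lactB.
Qed.

End Action.

Definition selfadj_mx k (A : 'M[grpalg G]_k) :=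
  forall i j, A i j = gastar (A j i).

Lemma selfadj_proj_diag k (A : 'M[grpalg G]_k) i : selfadj_mx A ->
  A *m A = A ->
  gcoef 1%g (A i i) = \sum_j gcoef 1%g (gastar (A j i) * A j i).
Proof.
move=> Asa AA; rewrite -{1}AA mxE raddf_sum; apply: eq_bigr => j _ /=.
by rewrite {1}Asa.
Qed.

Lemma gcoef1_starM_ge0 a : 0 <= gcoef 1%g (gastar a * a).
Proof. by rewrite gtrace_starM; apply: sumr_ge0 => x _; rewrite -expr2 sqr_ge0. Qed.

(** A projection sends the [i]-th basis vector to its [i]-th column, whose squared
    norm is its [i]-th diagonal trace. *)
Lemma selfadj_proj_sum_le k (A : 'M[grpalg G]_k) i j (s : seq G) :
  selfadj_mx A -> A *m A = A -> uniq s ->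
  \sum_(x <- s) gcoef x (A j i) ^+ 2 <= gcoef 1%g (A i i).
Proof.
move=> Asa AA us; rewrite (selfadj_proj_diag i Asa AA) (bigD1 j) //=.
apply: le_trans (sum_gcoef_sq_le _ us) _; rewrite lerDl.
by apply: sumr_ge0 => l _; exact: gcoef1_starM_ge0.
Qed.

Lemma selfadj_proj_diag_ge0 k (A : 'M[grpalg G]_k) i :
  selfadj_mx A -> A *m A = A -> 0 <= gcoef 1%g (A i i).
Proof.
move=> Asa AA; have := selfadj_proj_sum_le i i Asa AA (isT : uniq [::]).
by rewrite big_nil.
Qed.

Lemma selfadj_mxB k (A B : 'M[grpalg G]_k) :
  selfadj_mx A -> selfadj_mx B -> selfadj_mx (A - B).
Proof. by move=> hA hB i j; rewrite !mxE raddfB /= hA hB. Qed.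

Lemma selfadj_mx1 k : selfadj_mx (1%:M : 'M[grpalg G]_k).
Proof.
move=> i j; rewrite !mxE eq_sym.
by case: eqP => _ /=; rewrite ?gastar1 ?raddf0.
Qed.

Lemma gcoef1_compl k (A : 'M[grpalg G]_k) i :
  gcoef 1%g ((1%:M - A) i i) = 1 - gcoef 1%g (A i i).
Proof. by rewrite !mxE eqxx raddfB /= gcoef1_one. Qed.

End GroupAlgebraTheory.

(** * Computing an l2-Betti number by exhaustion *)

Section Exhaustion.
Variable R : realType.
Local Open Scope classical_set_scope.

Lemma cvg_seqsum I (s : seq I) (u : I -> nat -> R) (l : I -> R) :
  (forall i, u i @ \oo --> l i) ->
  (fun n => \sum_(i <- s) u i n) @ \oo --> \sum_(i <- s) l i.
Proof.
move=> ul; elim: s => [|i s IHs].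
  rewrite big_nil (_ : (fun _ => _) = fun=> 0); first exact: cvg_cst.
  by apply/funext => n; rewrite big_nil.
rewrite big_cons (_ : (fun _ => _) = fun n => u i n + \sum_(j <- s) u j n).
  exact: cvgD.
by apply/funext => n; rewrite big_cons.
Qed.

(** The hypothesis bounds the square of an increment of [u] by an increment of a
    convergent monotone sequence, so [u] is Cauchy. *)
Lemma cvg_of_sq_increments (u t : nat -> R) :
  (forall n m, (n <= m)%N -> (u m - u n) ^+ 2 <= t m - t n) ->
  cvgn t -> cvgn u.
Proof.
move=> ut tc; apply: cauchy_cvg; apply: cauchy_exP => e e0.
have tmono n m : (n <= m)%N -> t n <= t m.
  by move=> /ut; have := sqr_ge0 (u m - u n); lra.
have e2 : 0 < e ^+ 2 by rewrite exprn_gt0.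
have : \forall n \near \oo, limn t - e ^+ 2 < t n.
  by apply: (cvgr_gt (limn t)); [exact: tc|rewrite gtrBl].
move=> [N _ hN]; exists (u N); exists N => // n /= Nn.
rewrite /ball /=; rewrite -ltr_sqr ?nnegrE ?normr_ge0 ?ltW // real_normK ?num_real //.
rewrite -[_ - _]opprB sqrrN; apply: le_lt_trans (ut _ _ Nn) _.
have := hN N (leqnn N); have := nondecreasing_cvgn_le tmono tc n; rewrite /=; lra.
Qed.

Lemma ratrC (q : rat) : ratr q = (ratr q : R)%:C%C :> R[i].
Proof. exact: esym (fmorph_rat (real_complex R) q). Qed.

Variables (G : groupType) (k : nat).
Implicit Types (A : 'M[grpalg G]_k) (u v w : 'I_k -> G -> R[i]).

Lemma Re_sum I (s : seq I) (F : I -> R[i]) :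
  complex.Re (\sum_(i <- s) F i) = \sum_(i <- s) complex.Re (F i).
Proof. by apply: (big_morph _ _ _) => // -[a b] [c d]. Qed.

Lemma innervBl v w u : ell2v v -> ell2v w -> ell2v u ->
  innerv (fun i x => v i x - w i x) u = innerv v u - innerv w u.
Proof.
by move=> hv hw hu; rewrite /innerv -sumrB; apply: eq_bigr => i _; exact: innerBl.
Qed.

Lemma ell2vB v w : ell2v v -> ell2v w -> ell2v (fun i x => v i x - w i x).
Proof. by move=> hv hw i; exact: ell2B. Qed.

(** Definiteness of the inner product makes orthogonal projections unique. *)
Lemma innerv_self0 v : ell2v v -> innerv v v = 0 -> forall i x, v i x = 0.
Proof.
move=> hv v0 i x; apply: sqn_eq0 (hv i) _ x; move: v0 => /(congr1 (@complex.Re R)).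
rewrite /innerv Re_sum => /eqP; rewrite psumr_eq0 => [/allP h|j _]; last first.
  by rewrite Re_inner_self ?sqn_ge0.
by rewrite -Re_inner_self //; apply/eqP/h; rewrite mem_index_enum.
Qed.

Lemma mxactBr A v w i x :
  mxact A (fun j y => v j y - w j y) i x = mxact A v i x - mxact A w i x.
Proof.
rewrite /mxact -sumrB; apply: eq_bigr => j _; rewrite /lact -sumrB.
by apply: eq_bigr => g _; rewrite mulrBr.
Qed.

Lemma orth_projE A v w : ell2v v -> mxker A w ->
  (forall u, mxker A u -> innerv (fun i x => v i x - w i x) u = 0) ->
  orth_proj (mxker A) v = w.
Proof.
move=> hv Aw ow; apply: xget_unique => // w' [Aw' ow'].
have [hw Aw0] := Aw; have [hw' Aw'0] := Aw'.
pose d : 'I_k -> G -> R[i] := fun i x => w' i x - w i x.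
have dK : mxker A d.
  by split; [exact: ell2vB|move=> i x; rewrite mxactBr Aw0 Aw'0 subr0].
apply/funext => i; apply/funext => x; apply/eqP; rewrite -subr_eq0; apply/eqP.
apply: (@innerv_self0 d) => //; first by case: dK.
have [hd _] := dK.
have := ow _ dK; have := ow' _ dK.
rewrite (innervBl hv hw' hd) (innervBl hv hw hd) => h' h.
by rewrite {1}/d (innervBl hw' hw hd) -[LHS](subrKA (innerv v d)) h addr0 -opprB h' oppr0.
Qed.

(** The image by [B] of the vector with [xi_e] in position [i] and 0 elsewhere. *)
Definition mxcol_vec (B : 'M[grpalg G]_k) (i : 'I_k) : 'I_k -> G -> R[i] :=
  fun j x => ratr (gcoef x (B j i)).

Lemma mxcol_vec_ell2 B i : ell2v (mxcol_vec B i).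
Proof.
move=> j; apply: (@fin_ell2 _ _ (msupp (B j i))) => x.
by move=> /mcoeff_outdom; rewrite /mxcol_vec /gcoef => ->; rewrite rmorph0.
Qed.

Lemma xi_at_mxcol i : xi_at R i = mxcol_vec 1%:M i.
Proof.
apply/funext => j; apply/funext => x; rewrite /xi_at /mxcol_vec /xi_e mxE.
case: (j =P i) => _ /=; last by rewrite raddf0 rmorph0.
by rewrite (gcoef_term 1 1%g x) eq_sym; case: eqP; rewrite ?rmorph1 ?rmorph0.
Qed.

Lemma mxact_mxcol A B i j x : mxact A (mxcol_vec B i) j x = mxcol_vec (A *m B) i j x.
Proof.
rewrite /mxact /mxcol_vec mxE raddf_sum rmorph_sum; apply: eq_bigr => l _.
exact: lact_gcoef.
Qed.

(** Moving a self-adjoint [B] to the other side leaves a value of [B u] at 1; only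
    finite sums occur, because the entries of [B] have finite support. *)
Lemma innerv_mxcol B i u : selfadj_mx B ->
  innerv (mxcol_vec B i) u = (mxact B u i 1%g)^*.
Proof.
move=> Bsa; rewrite /innerv /mxact rmorph_sum; apply: eq_bigr => j _.
rewrite Bsa lact_star1 rmorph_sum (inner_fin _ (fset_uniq (msupp (B j i)))).
  apply: eq_bigr => x _; rewrite rmorphM /=; congr (_ * _).
  by rewrite /mxcol_vec ratrC; exact/esym/conjc_real.
by move=> x /mcoeff_outdom; rewrite /mxcol_vec /gcoef => ->; rewrite rmorph0.
Qed.

(** The [P n] are projections onto increasing parts of the kernel of [A]. By the
    equation [P n = Z n - B n A], a kernel vector is fixed by [P n] as soon as it
    is fixed by [Z n], and the [Z n] exhaust the whole space. *)
Section Limit.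
Variables (A : 'M[grpalg G]_k) (P Z B : nat -> 'M[grpalg G]_k).
Hypothesis PA : forall n, A *m P n = 0.
Hypothesis PZ : forall n, P n = Z n - B n *m A.
Hypothesis Psa : forall n, selfadj_mx (P n).
Hypothesis Zsa : forall n, selfadj_mx (Z n).
Hypothesis PP : forall n m, (n <= m)%N -> P n *m P m = P n /\ P m *m P n = P n.
Hypothesis ZZ : forall n, Z n *m Z n = Z n.
Hypothesis Z1 : forall i, (fun n => ratr (gcoef 1%g (Z n i i)) : R) @ \oo --> (1 : R).

Section Column.
Variable i : 'I_k.
Let tau n : R := ratr (gcoef 1%g (P n i i)).
Let f n j x : R := ratr (gcoef x (P n j i)).

Let Pproj n m : (n <= m)%N -> (P m - P n) *m (P m - P n) = P m - P n.
Proof.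
move=> nm; rewrite mulmxBl !mulmxBr (PP nm).1 (PP nm).2.
by rewrite !(PP (leqnn _)).1 subrr subr0.
Qed.

(* The difference [P m - P n] is a projection, so the squared norms of its columns
   are increments of [tau]. *)
Let increment_le n m j s : (n <= m)%N -> uniq s ->
  \sum_(x <- s) (f m j x - f n j x) ^+ 2 <= tau m - tau n.
Proof.
move=> nm us; rewrite /tau /f -raddfB -(raddfB (gcoef 1%g)).
under eq_bigr do rewrite -raddfB -(raddfB (gcoef _)) -rmorphXn.
rewrite /= -rmorph_sum ler_rat.
have := selfadj_proj_sum_le i j (selfadj_mxB (Psa m) (Psa n)) (Pproj nm) us.
by rewrite !mxE.
Qed.

Let tau_homo : {homo tau : n m / (n <= m)%N >-> n <= m}.
Proof.
move=> n m nm; have := @increment_le n m i [::] nm isT.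
by rewrite big_nil subr_ge0.
Qed.

Let tau_cvg : cvgn tau.
Proof.
apply: nondecreasing_is_cvgn; first exact: tau_homo.
exists 1 => _ [n _ <-]; rewrite /tau -subr_ge0 -(rmorph1 (ratr : rat -> R)) -rmorphB ler0q.
have := selfadj_proj_diag_ge0 i (selfadj_mxB (@selfadj_mx1 G k) (Psa n)).
rewrite mulmxBl !mulmxBr !mul1mx !mulmx1 (PP (leqnn n)).1 subrr subr0.
by move=> /(_ erefl); rewrite gcoef1_compl.
Qed.

Let f_cvg j x : cvgn (fun n => f n j x).
Proof.
apply: cvg_of_sq_increments tau_cvg => n m nm.
by have := increment_le j nm (isT : uniq [:: x]); rewrite big_seq1.
Qed.

Let fl j x : R := limn (fun n => f n j x).
(* The pointwise limit of the vectors [P n xi_i]; it will be the projection of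
   [xi_i] onto the kernel of [A]. *)
Let w j x : R[i] := (fl j x)%:C%C.

Let tail_le n j s : uniq s ->
  \sum_(x <- s) (fl j x - f n j x) ^+ 2 <= limn tau - tau n.
Proof.
move=> us; apply: (@ler_cvg_to _ \oo _ R
    (fun m => \sum_(x <- s) (f m j x - f n j x) ^+ 2) (fun m => tau m - tau n)).
- apply: cvg_seqsum => x.
  apply: (@cvg_comp _ _ _ (fun m => f m j x - f n j x) (fun y : R => y ^+ 2)).
    by apply: cvgB; [exact: f_cvg|exact: cvg_cst].
  exact: exprn_continuous.
- by apply: cvgB; [exact: tau_cvg|exact: cvg_cst].
- by exists n => // m /= nm; exact: increment_le.
Qed.

Let tail_ell2 n j : ell2 (fun x => w j x - mxcol_vec (P n) i j x) /\
  sqn (fun x => w j x - mxcol_vec (P n) i j x) <= limn tau - tau n.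
Proof.
apply: sqn_le => s us; apply: le_trans (tail_le n j us).
rewrite le_eqVlt; apply/orP; left; apply/eqP; apply: eq_bigr => x _.
by rewrite /mxcol_vec ratrC /sqnorm /= subrr expr0n addr0.
Qed.

Let w_ell2 : ell2v w.
Proof.
move=> j; have [h _] := tail_ell2 0 j.
have c0 : ell2 (fun x => 0 - mxcol_vec (P 0%N) i j x).
  apply: ell2B; last exact: mxcol_vec_ell2.
  exact: (@fin_ell2 _ _ [::]).
have := ell2B h c0; congr ell2; apply/funext => x.
by rewrite sub0r opprK subrK.
Qed.

Let w_ker : mxker A w.
Proof.
split=> [|j x]; first exact: w_ell2.
have lactC a g : lact a (fun y => (g y)%:C%C) x =
    (\sum_(h <- msupp a) ratr (gcoef h a) * g (h^-1 * x)%g : R)%:C%C.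
  rewrite /lact rmorph_sum; apply: eq_bigr => h _.
  by rewrite rmorphM /= ratrC.
rewrite /mxact; under eq_bigr do rewrite lactC.
rewrite -rmorph_sum; apply/eqP; rewrite -(rmorph0 (real_complex R)).
rewrite (inj_eq (@complexI R)); apply/eqP.
apply: (@cvg_unique _ _ ((fun n => \sum_l \sum_(h <- msupp (A j l))
    ratr (gcoef h (A j l)) * f n l (h^-1 * x)%g : R) @ \oo)) => //.
- apply: (@cvg_seqsum _ _ (fun l n => \sum_(h <- msupp (A j l))
    ratr (gcoef h (A j l)) * f n l (h^-1 * x)%g)) => l; apply: cvg_seqsum => h.
  by apply: cvgMr; exact: f_cvg.
suff -> : (fun n => \sum_l \sum_(h <- msupp (A j l))
    ratr (gcoef h (A j l)) * f n l (h^-1 * x)%g : R) = fun=> 0 by exact: cvg_cst.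
apply/funext => n; apply: (@complexI R); rewrite rmorph_sum rmorph0.
transitivity (mxact A (mxcol_vec (P n) i) j x); last first.
  by rewrite mxact_mxcol PA /mxcol_vec mxE raddf0 rmorph0.
apply: eq_bigr => l _; rewrite /= -[LHS](lactC _ (f n l)).
congr lact; apply/funext => y.
by rewrite /mxcol_vec ratrC.
Qed.

Let w_orth u : mxker A u -> innerv (fun j x => @xi_at R G k i j x - w j x) u = 0.
Proof.
move=> [u2 Au].
pose zeta n := mxcol_vec (1%:M - Z n) i.
pose rho n j x : R[i] := w j x - mxcol_vec (P n) i j x.
have zeta2 n : ell2v (zeta n) by exact: mxcol_vec_ell2.
have rho2 n : ell2v (rho n) by move=> j; have [] := tail_ell2 n j.
have xi2 : ell2v (@xi_at R G k i) by rewrite xi_at_mxcol; exact: mxcol_vec_ell2.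
(* [P n u = Z n u] because [u] is killed by [A] *)
have PZu n : mxact (P n) u i 1%g = mxact (Z n) u i 1%g.
  rewrite PZ mxactB mxactM [X in _ - X](_ : _ = 0) ?subr0 //.
  rewrite /mxact big1 // => j _; rewrite /lact big1 // => g _.
  by rewrite [X in _ * X]Au mulr0.
have split_inner n : innerv (fun j x => @xi_at R G k i j x - w j x) u =
    innerv (zeta n) u - innerv (rho n) u.
  rewrite (innervBl xi2 w_ell2 u2) (innervBl w_ell2 (mxcol_vec_ell2 (P n) i) u2).
  rewrite xi_at_mxcol !innerv_mxcol //; first last.
  - exact: selfadj_mx1.
  - by apply: selfadj_mxB => //; exact: selfadj_mx1.
  by rewrite PZu mxactB rmorphB /= opprB addrA subrK.
(* [del n] bounds the squared norms of [zeta n] and [rho n], summed over the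
   coordinates. *)
pose del n : R := k%:R * ((1 - ratr (gcoef 1%g (Z n i i))) + (limn tau - tau n)).
have del0 : del @ \oo --> (0 : R).
  rewrite -(mulr0 k%:R); apply: cvgMr; rewrite -(addr0 0); apply: cvgD.
    by rewrite -(subrr 1); apply: cvgB; [exact: cvg_cst|exact: Z1].
  by rewrite -(subrr (limn tau)); apply: cvgB; [exact: cvg_cst|exact: tau_cvg].
have zeta_le n j : sqn (zeta n j) <= 1 - ratr (gcoef 1%g (Z n i i)).
  have [] // := @sqn_le R G (zeta n j) (1 - ratr (gcoef 1%g (Z n i i))) => s us.
  have ZZ1 : (1%:M - Z n) *m (1%:M - Z n) = 1%:M - Z n.
    by rewrite mulmxBl !mulmxBr !mul1mx !mulmx1 ZZ subrr subr0.
  have := selfadj_proj_sum_le i j (selfadj_mxB (@selfadj_mx1 G k) (Zsa n)) ZZ1 us.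
  rewrite gcoef1_compl => h.
  have -> : 1 - ratr (gcoef 1%g (Z n i i)) = ratr (1 - gcoef 1%g (Z n i i)) :> R.
    by rewrite rmorphB rmorph1.
  have -> : \sum_(x <- s) sqnorm (zeta n j x) =
      ratr (\sum_(x <- s) gcoef x ((1%:M - Z n) j i) ^+ 2).
    rewrite rmorph_sum; apply: eq_bigr => x _.
    by rewrite /zeta /mxcol_vec ratrC /sqnorm /= expr0n addr0 rmorphXn.
  by rewrite ler_rat.
pose U := \sum_j sqn (u j) *+ 2.
have bound n (c : R) : 0 < c ->
   `|complex.Re (innerv (fun j x => @xi_at R G k i j x - w j x) u)| <=
     c * del n + c^-1 * U /\
   `|complex.Im (innerv (fun j x => @xi_at R G k i j x - w j x) u)| <=
     c * del n + c^-1 * U.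
  move=> c0.
  have hb j : let d := c * (1 - ratr (gcoef 1%g (Z n i i)) + (limn tau - tau n))
      + c^-1 * (sqn (u j) *+ 2) in
    `|complex.Re (inner (zeta n j) (u j) - inner (rho n j) (u j))| <= d /\
    `|complex.Im (inner (zeta n j) (u j) - inner (rho n j) (u j))| <= d.
    have [rz iz] := inner_le c0 (zeta2 n j) (u2 j).
    have [rr ir] := inner_le c0 (rho2 n j) (u2 j).
    have cz : c * sqn (zeta n j) <= c * (1 - ratr (gcoef 1%g (Z n i i))).
      by rewrite ler_pM2l.
    have cr : c * sqn (rho n j) <= c * (limn tau - tau n).
      by rewrite ler_pM2l //; have [] := tail_ell2 n j.
    move=> d; rewrite ReB ImB {}/d mulrDr mulrnAr mulr2n.
    by split; apply: le_trans (ler_normB _ _) _; lra.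
  have sumE : c * del n + c^-1 * U = \sum_(j < k)
     (c * (1 - ratr (gcoef 1%g (Z n i i)) + (limn tau - tau n)) + c^-1 * (sqn (u j) *+ 2)).
    by rewrite big_split /= -!mulr_sumr sumr_const card_ord /del mulr_natl.
  have ImSum I (s : seq I) (F : I -> R[i]) :
      complex.Im (\sum_(i <- s) F i) = \sum_(i <- s) complex.Im (F i).
    by apply: (big_morph _ _ _) => // -[a b] [c' d].
  rewrite (split_inner n) /innerv -sumrB Re_sum ImSum sumE.
  by split; apply: le_trans (ler_norm_sum _ _ _) _; apply: ler_sum => j _; have [] := hb j.
(* Let [n] and then [c] tend to infinity. *)
have small (z : R) : (forall n (c : R), 0 < c -> `|z| <= c * del n + c^-1 * U) -> z = 0.
  move=> hz; have hz' c : 0 < c -> `|z| <= c^-1 * U.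
    move=> c0; apply: (@ler_cvg_to _ \oo _ R (fun=> `|z|) (fun n => c * del n + c^-1 * U)).
    - exact: cvg_cst.
    - rewrite -{2}[c^-1 * U]add0r; apply: cvgD; last exact: cvg_cst.
      by rewrite -(mulr0 c); apply: cvgMr.
    - by exists 0%N => // n _; exact: hz.
  have U0 : 0 <= U by apply: sumr_ge0 => j _; rewrite mulrn_wge0 ?sqn_ge0.
  apply/eqP; rewrite -normr_le0 leNgt; apply/negP => z0.
  have c0 : 0 < (U + 1) / `|z| by rewrite divr_gt0 // ltr_wpDl.
  have := hz' _ c0; rewrite invfM invrK -mulrA ler_pdivlMl ?ltr_wpDl //.
  by rewrite mulrC ler_pM2l // gerDl ler10.
have [re0 im0] : complex.Re (innerv (fun j x => @xi_at R G k i j x - w j x) u) = 0 /\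
    complex.Im (innerv (fun j x => @xi_at R G k i j x - w j x) u) = 0.
  by split; apply: small => n c c0; have [] := bound n c c0.
by apply/eqP; rewrite eq_complex re0 im0 !eqxx.
Qed.

Lemma orth_proj_column_cvg :
  tau @ \oo --> complex.Re (inner (orth_proj (mxker A) (@xi_at R G k i) i) (@xi_e R G)).
Proof.
have xi2 : ell2v (@xi_at R G k i) by rewrite xi_at_mxcol; exact: mxcol_vec_ell2.
rewrite (orth_projE xi2 w_ker w_orth).
have -> : complex.Re (inner (w i) (@xi_e R G)) = fl i 1%g.
  have e0 (x : G) : x \notin [:: 1%g] -> xi_e R x = 0.
    by rewrite inE /xi_e => /negbTE ->.
  have h : (fun x => w i x * (xi_e R x)^*) =
      fun x => (if x == 1%g then w i 1%g else 0) * 1^*.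
    apply/funext => x; rewrite /xi_e; case: eqP => [->|_]; first by [].
    by rewrite rmorph0 mulr0 mul0r.
  rewrite /inner h -/(inner (fun x => if x == 1%g then w i 1%g else 0) (fun=> 1)).
  rewrite (@inner_fin _ _ [:: 1%g]) //; last first.
    by move=> x; rewrite inE => /negbTE ->.
  by rewrite big_seq1 eqxx rmorph1 mulr1.
exact: f_cvg.
Qed.

End Column.

Lemma l2betti_exhaustion :
  (fun n => ratr (\sum_i gcoef 1%g (P n i i)) : R) @ \oo --> l2betti R A.
Proof.
rewrite /l2betti /vnTr Re_sum.
rewrite (_ : (fun n => _) = fun n => \sum_i (ratr (gcoef 1%g (P n i i)) : R)).
  by apply: cvg_seqsum => i; exact: orth_proj_column_cvg.
by apply/funext => n; rewrite rmorph_sum.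
Qed.

End Limit.
End Exhaustion.

(** * Configurations and the lamplighter group *)

Section HalfIdempotents.
Variable A : algType rat.
Implicit Types (a c t : A) (b : bool).

(** For an involution [a], the projections onto its eigenspaces for 1 (if [b] is
    false) and -1 (if [b] is true). *)
Definition half_idem a b : A := 2^-1 *: (1 + (-1) ^+ b *: a).

Lemma half_idemM a b b' : a * a = 1 ->
  half_idem a b * half_idem a b' = if b == b' then half_idem a b else 0.
Proof.
move=> aa; rewrite /half_idem -!scalerAl -!scalerAr.
rewrite !mulrDl !mulrDr !mul1r !mulr1 -!scalerAl -!scalerAr aa.
case: eqP => [<-|/eqP bb'].
  rewrite [X in _ + (_ + X)]scalerA -expr2 sqrr_sign scale1r.
  by rewrite [_ + 1]addrC -mulr2n -scaler_nat [2^-1 *: (2%:R *: _)]scalerA mulVf // scale1r.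
have -> : (-1) ^+ b' = - (-1) ^+ b :> rat by case: b b' bb' => -[].
rewrite [X in _ + (_ + X)]scalerA mulrN -expr2 sqrr_sign !scaleNr scale1r.
by rewrite addrA subrK subrr !scaler0.
Qed.

Lemma half_idemC a c b b' : a * c = c * a ->
  half_idem a b * half_idem c b' = half_idem c b' * half_idem a b.
Proof.
move=> ac.
have commZ (q : rat) (u v : A) : GRing.comm u v -> GRing.comm u (q *: v).
  by move=> uv; rewrite /GRing.comm -scalerAr -scalerAl uv.
apply: (commZ); apply: commrD; first exact: commr1.
apply: (commZ); apply/commr_sym; apply: (commZ); apply: commrD; first exact: commr1.
by apply: (commZ); apply/commr_sym.
Qed.

Lemma half_idem_conj t a c b : t * a = c * t ->
  t * half_idem a b = half_idem c b * t.
Proof.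
move=> tac; rewrite /half_idem -scalerAr -scalerAl mulrDr mulrDl mul1r mulr1.
by rewrite -scalerAr -scalerAl tac.
Qed.

Lemma half_idem_mul a b c :
  half_idem a b * c = 2^-1 *: (c + (-1) ^+ b *: (a * c)).
Proof. by rewrite /half_idem -scalerAl mulrDl mul1r -scalerAl. Qed.

Lemma half_idem_fixed (f : A -> A) a b :
  (forall x y, f (x + y) = f x + f y) -> (forall q x, f (q *: x) = q *: f x) ->
  f 1 = 1 -> f a = a -> f (half_idem a b) = half_idem a b.
Proof. by move=> fD fZ f1 fa; rewrite /half_idem fZ fD fZ f1 fa. Qed.

End HalfIdempotents.

Section Cylinders.
Variables (A : pzRingType) (e : int -> bool -> A).

(** Indicator of the configurations that agree with [x] on the window [r]. *)
Definition cylinder (x : int -> bool) (r : seq int) : A := \prod_(i <- r) e i (x i).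

Lemma cylinder_nil x : cylinder x [::] = 1.
Proof. by rewrite /cylinder big_nil. Qed.

Lemma cylinder_cons x i r : cylinder x (i :: r) = e i (x i) * cylinder x r.
Proof. by rewrite /cylinder big_cons. Qed.

End Cylinders.

(** The relations between the shift [t], the coordinate projections of the space
    of configurations [int -> bool], the involution and the trace, from which
    everything about blocks follows. By [ftr_cylinder] the trace is the integral
    for the uniform measure on configurations. *)
Record shift_frame (A : algType rat) := ShiftFrame {
  fstar : A -> A;
  ftr : A -> rat;
  ft : int -> A;
  fe : int -> bool -> A;
  fstarD : forall a b, fstar (a + b) = fstar a + fstar b;
  fstarZ : forall q a, fstar (q *: a) = q *: fstar a;
  fstarM : forall a b, fstar (a * b) = fstar b * fstar a;
  fstar1 : fstar 1 = 1;
  fstarK : forall a, fstar (fstar a) = a;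
  ft0 : ft 0 = 1;
  ftD : forall n m, ft n * ft m = ft (n + m);
  fstar_t : forall n, fstar (ft n) = ft (- n);
  feM : forall i b b', fe i b * fe i b' = if b == b' then fe i b else 0;
  feC : forall i j b b', fe i b * fe j b' = fe j b' * fe i b;
  fstar_e : forall i b, fstar (fe i b) = fe i b;
  ft_e : forall n i b, ft n * fe i b = fe (i - n) b * ft n;
  ftrD : forall a b, ftr (a + b) = ftr a + ftr b;
  ftrZ : forall q a, ftr (q *: a) = q * ftr a;
  ftr_cylinder : forall n m x r, uniq r ->
    ftr (ft n * cylinder fe x r * ft m) =
    if n + m == 0 then 2^-1 ^+ size r else 0
}.

Section LampElements.
Local Notation GA := (grpalg lamplighter).
Implicit Types (i j n m : int) (b : bool) (x : int -> bool) (r : seq int).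

Definition shift_el n : GA := gabase (Lamp 0 n).
Definition lamp_el i : GA := gabase (lamp_a i).
Definition lamp_idem i b : GA := half_idem (lamp_el i) b.

Lemma lamp_ext (g h : lamplighter) :
  (forall i, (lamps g)@_i = (lamps h)@_i) -> pos g = pos h -> g = h.
Proof. by case: g h => [f n] [f' n'] /= /malgP -> ->. Qed.

Lemma lamps_mul (g h : lamplighter) i :
  (lamps (g * h)%g)@_i = (lamps g)@_i + (lamps h)@_(i + pos g).
Proof. by rewrite mcoeffD lshiftnE. Qed.

Lemma shift_el0 : shift_el 0 = 1. Proof. by []. Qed.

Lemma shift_elD n m : shift_el n * shift_el m = shift_el (n + m).
Proof.
transitivity (gabase (Lamp 0 n * Lamp 0 m)%g); first exact: gabase_mul.
apply: (congr1 (@gabase _)); apply: lamp_ext => // i.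
by rewrite lamps_mul /= !mcoeff0 addr0.
Qed.

Lemma shift_lamp n i : shift_el n * lamp_el i = lamp_el (i - n) * shift_el n.
Proof.
transitivity (gabase (Lamp 0 n * lamp_a i)%g); first exact: gabase_mul.
transitivity (gabase (lamp_a (i - n) * Lamp 0 n)%g); last exact/esym/gabase_mul.
apply: (congr1 (@gabase _)).
apply: lamp_ext => [k|]; last by rewrite /= addr0 add0r.
rewrite !lamps_mul /= !mcoeff0 add0r addr0 !mcoeffU; congr (_ *+ nat_of_bool _).
by rewrite subr_eq.
Qed.

Lemma lamp_el_sq i : lamp_el i * lamp_el i = 1.
Proof. by rewrite (gabase_mul (lamp_a i) (lamp_a i)) lamp_a_sq. Qed.

Lemma lamp_elC i j : lamp_el i * lamp_el j = lamp_el j * lamp_el i.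
Proof.
transitivity (gabase (lamp_a i * lamp_a j)%g); first exact: gabase_mul.
by rewrite lamp_aC; exact/esym/gabase_mul.
Qed.

Lemma star_shift_el n : gastar (shift_el n) = shift_el (- n).
Proof.
rewrite gastar_base; apply: (congr1 (@gabase _)); apply: lamp_ext => // i /=.
by rewrite mcoeffN lshiftnE !mcoeff0 oppr0.
Qed.

Lemma lamp_a_inv i : (lamp_a i)^-1%g = lamp_a i.
Proof. by rewrite -[LHS]mulg1 -(lamp_a_sq i) mulKg. Qed.

Lemma star_lamp_el i : gastar (lamp_el i) = lamp_el i.
Proof. by rewrite gastar_base lamp_a_inv. Qed.

Lemma lamp_eE i : lamp_e i = lamp_idem i false.
Proof. by rewrite /lamp_idem /half_idem expr0 scale1r. Qed.

Lemma lamp_e_compl i : 1 - lamp_e i = lamp_idem i true.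
Proof.
suff h (A : algType rat) (a : A) : 1 - 2^-1 *: (1 + a) = half_idem a true.
  exact: (h _ (lamp_el i)).
rewrite /half_idem expr1 scaleN1r !scalerDr scalerN opprD addrA.
by congr (_ - _); rewrite -{1}[1]scale1r -scalerBl.
Qed.

Lemma star_lamp_idem i b : gastar (lamp_idem i b) = lamp_idem i b.
Proof.
apply: half_idem_fixed.
- exact: gastarD.
- exact: gastarZ.
- exact: gastar1.
- exact: star_lamp_el.
Qed.

Lemma shift_idem n i b : shift_el n * lamp_idem i b = lamp_idem (i - n) b * shift_el n.
Proof. exact/half_idem_conj/shift_lamp. Qed.

Lemma lamp_idemC i j b b' : lamp_idem i b * lamp_idem j b' = lamp_idem j b' * lamp_idem i b.
Proof. exact/half_idemC/lamp_elC. Qed.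

Lemma lamp_idemM i b b' :
  lamp_idem i b * lamp_idem i b' = if b == b' then lamp_idem i b else 0.
Proof. exact/half_idemM/lamp_el_sq. Qed.

Lemma gcoef_idemM i b a g : gcoef g (lamp_idem i b * a) =
  2^-1 * (gcoef g a + (-1) ^+ b * gcoef (lamp_a i * g)%g a).
Proof.
rewrite /lamp_idem half_idem_mul gcoefZ gcoefD gcoefZ.
by rewrite (gcoef_termM 1 (lamp_a i)) mul1r lamp_a_inv.
Qed.

Lemma cylinder_supp x r g : gcoef g (cylinder lamp_idem x r) != 0 ->
  pos g = 0 /\ forall i, i \notin r -> (lamps g)@_i = 0.
Proof.
elim: r g => [|i r IHr] g.
  rewrite cylinder_nil (gcoef_term 1 1%g g); case: (1%g =P g) => [<-|//] _.
  by split=> // j _; rewrite mcoeff0.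
rewrite cylinder_cons gcoef_idemM.
have [g0|/IHr[pg lg] _] := eqVneq (gcoef g (cylinder lamp_idem x r)) 0; last first.
  by split=> // j; rewrite inE => /norP[_ /lg].
rewrite g0 add0r mulf_eq0 mulf_eq0 !negb_or => /andP[_ /andP[_ /IHr[pg lg]]].
split; first by rewrite -pg /= add0r.
move=> j; rewrite inE => /norP[ji /lg]; rewrite lamps_mul /= addr0 mcoeffU.
by rewrite eq_sym (negbTE ji) add0r.
Qed.

(** Multiplying by the projection of a new coordinate [i] adds terms that contain
    [a_i] and halves the others, so the coefficient of 1 is halved. *)
Lemma gtrace_cylinder x r : uniq r -> gcoef 1%g (cylinder lamp_idem x r) = 2^-1 ^+ size r.
Proof.
elim: r => [|i r IHr] /=; first by rewrite cylinder_nil gcoef1_one.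
move=> /andP[ir ur]; rewrite cylinder_cons gcoef_idemM IHr // exprS.
rewrite [gcoef _ _](_ : _ = 0) ?mulr0 ?addr0 //.
apply/eqP/negPn/negP => /cylinder_supp[_ /(_ i ir)].
by rewrite mulg1 mcoeffU eqxx.
Qed.

Lemma gtrace_shift_cylinder n m x r : uniq r ->
  gcoef 1%g (shift_el n * cylinder lamp_idem x r * shift_el m) =
  if n + m == 0 then 2^-1 ^+ size r else 0.
Proof.
move=> ur; rewrite (gcoef_mterm 1 (Lamp 0 m)) mulr1 (gcoef_termM 1 (Lamp 0 n)) !mul1r mul1g.
rewrite -invgM.
case: eqP => [nm|nm].
  rewrite -(gtrace_cylinder x ur); congr gcoef; apply/eqP; rewrite invg_eq1.
  apply/eqP/lamp_ext => [i|]; last by rewrite /= addrC.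
  by rewrite lamps_mul !mcoeff0 addr0.
apply/eqP/negPn/negP => /cylinder_supp[/= /eqP]; rewrite oppr_eq0 addrC => /eqP.
by move=> /nm.
Qed.

Definition lamp_frame : shift_frame GA :=
  @ShiftFrame GA (@gastar _) (gcoef 1%g) shift_el lamp_idem
    (@gastarD _) (@gastarZ _) (@gastarM _) (@gastar1 _) (@gastarK _)
    shift_el0 shift_elD star_shift_el lamp_idemM lamp_idemC star_lamp_idem
    shift_idem (gcoefD 1%g) (gcoefZ 1%g) gtrace_shift_cylinder.

End LampElements.

Section FrameCylinders.
Variables (A : algType rat) (L : shift_frame A).
Implicit Types (i j n m : int) (b : bool) (x : int -> bool) (r : seq int).
Local Notation star := (fstar L).
Local Notation tr := (ftr L).
Local Notation t := (ft L).
Local Notation e := (fe L).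
Local Notation cyl := (cylinder (fe L)).

Lemma idem_cylinderC i b x r :
  e i b * cyl x r = cyl x r * e i b.
Proof.
elim: r => [|j r IHr]; first by rewrite cylinder_nil mulr1 mul1r.
by rewrite cylinder_cons mulrA feC -mulrA IHr mulrA.
Qed.

Lemma idem_cylinder i b x r : i \in r ->
  e i b * cyl x r = if b == x i then cyl x r else 0.
Proof.
elim: r => // j r IHr; rewrite inE cylinder_cons mulrA.
case: (i =P j) => [->|_] /= h.
  by rewrite feM; case: eqP => [->|]; rewrite ?mul0r.
by rewrite feC -mulrA IHr //; case: eqP; rewrite ?mulr0.
Qed.

Lemma cylinder_idem x r : cyl x r * cyl x r = cyl x r.
Proof.
have h s : {subset s <= r} -> cyl x s * cyl x r = cyl x r.
  elim: s => [|i s IHs] sr; first by rewrite cylinder_nil mul1r.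
  rewrite cylinder_cons -mulrA IHs => [|k ks]; last by rewrite sr ?inE ?ks ?orbT.
  by rewrite idem_cylinder ?eqxx // sr ?mem_head.
exact: h.
Qed.

Lemma cylinder_conflict x r x' r' i : i \in r -> i \in r' -> x i != x' i ->
  cyl x r * cyl x' r' = 0.
Proof.
move=> ir ir' xx'.
have -> : cyl x r = cyl x r * e i (x i).
  by rewrite -idem_cylinderC idem_cylinder // eqxx.
have -> : cyl x' r' = e i (x' i) * cyl x' r'.
  by rewrite idem_cylinder // eqxx.
by rewrite mulrA -[_ * _ * e i (x' i)]mulrA feM (negbTE xx') mulr0 mul0r.
Qed.

Lemma shift_cylinder n x r : t n * cyl x r =
  cyl (fun i => x (i + n)) [seq i - n | i <- r] * t n.
Proof.
elim: r => [|i r IHr]; first by rewrite !cylinder_nil mulr1 mul1r.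
by rewrite /= !cylinder_cons mulrA ft_e -mulrA IHr mulrA subrK.
Qed.

Lemma star_cylinder x r : star (cyl x r) = cyl x r.
Proof.
elim: r => [|i r IHr]; first by rewrite cylinder_nil fstar1.
by rewrite cylinder_cons fstarM IHr fstar_e idem_cylinderC.
Qed.

End FrameCylinders.

(** * Blocks and their matrix units *)

Section BlockWords.
Implicit Types (w t : seq bool) (i j n : nat).

Definition no11 (b c : bool) := ~~ (b && c).

(** What remains of a block when its first letter, a 1, is removed. *)
Definition is_tail t := path no11 true t && last true t.

Definition is_block w := if w is b :: t then b && is_tail t else false.

(** A block is preceded and followed by a 1: both sides are cut inside a 11. *)
Definition extend w (i : int) : bool := if i is Posz n then nth true w n else true.

Definition window w : seq int := [seq k%:Z - 1 | k <- iota 0 (size w).+2].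

Lemma uniq_window w : uniq (window w).
Proof. by rewrite map_inj_uniq ?iota_uniq // => i j /addIr []. Qed.

Lemma size_window w : size (window w) = (size w).+2.
Proof. by rewrite size_map size_iota. Qed.

Lemma mem_window w (i : int) : (i \in window w) = (-1 <= i) && (i <= (size w)%:Z).
Proof.
apply/mapP/andP => [[k]|[h1 h2]].
  by rewrite mem_iota => /andP[_ hk] ->; split; lia.
by exists (absz (i + 1)); [rewrite mem_iota; lia|lia].
Qed.

Lemma block_size w : is_block w -> (0 < size w)%N.
Proof. by case: w. Qed.

Lemma extend_first w : is_block w -> extend w 0 = true.
Proof. by case: w => // b t /andP[]. Qed.

Lemma extend_last w : is_block w -> nth true w (size w).-1 = true.
Proof.
case: w => // -[] // t /andP[_ /andP[_ tl]].
by rewrite nth_last.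
Qed.

Lemma extend_beyond w n : (size w <= n)%N -> nth true w n = true.
Proof. exact: nth_default. Qed.

Lemma block_no11 w n : is_block w -> (n.+1 < size w)%N ->
  ~~ (nth true w n && nth true w n.+1).
Proof.
case: w => // b t /= /andP[bt /andP[/(pathP true) h _]]; rewrite ltnS => nt.
by have := h n nt; rewrite bt.
Qed.

(** Both occurrences of [w] at offset [-j] and of [w'] at offset [-k] cover the
    origin, and the maximal run through a given letter is unique. *)
Lemma block_conflict w w' j k : is_block w -> is_block w' ->
  (j < size w)%N -> (k < size w')%N -> (w, j) != (w', k) ->
  exists s : int, [/\ s \in window w, s + (k%:Z - j%:Z) \in window w' &
     extend w s != extend w' (s + (k%:Z - j%:Z))].
Proof.
move=> bw bw' jw kw' ne; apply: contrapT => no.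
have agree s : s \in window w -> s + (k%:Z - j%:Z) \in window w' ->
    extend w s = extend w' (s + (k%:Z - j%:Z)).
  by move=> h1 h2; apply/eqP/negPn/negP => h; apply: no; exists s.
(* If one occurrence began strictly inside the other, the 11 before it would lie in
   the other. *)
have jk : j = k.
  case: (ltngtP j k) => // [jk|kj]; exfalso.
    have a1 : nth true w' (k - j).-1 = true.
      have := agree (-1); rewrite !mem_window.
      rewrite (_ : -1 + (k%:Z - j%:Z) = Posz (k - j).-1); last by lia.
      by move=> h; symmetry; apply: h; lia.
    have a2 : nth true w' (k - j).-1.+1 = true.
      have := agree 0; rewrite !mem_window (extend_first bw).
      rewrite (_ : 0 + (k%:Z - j%:Z) = Posz (k - j).-1.+1); last by lia.
      by move=> h; symmetry; apply: h; lia.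
    have := block_no11 (n := (k - j).-1) bw'; rewrite a1 a2 => h.
    by suff : false by []; apply: h; lia.
  have a1 : nth true w (j - k).-1 = true.
    have := agree (Posz (j - k).-1); rewrite !mem_window.
    rewrite (_ : Posz (j - k).-1 + (k%:Z - j%:Z) = -1); last by lia.
    by apply; lia.
  have a2 : nth true w (j - k).-1.+1 = true.
    have := agree (Posz (j - k).-1.+1); rewrite !mem_window.
    rewrite (_ : Posz (j - k).-1.+1 + (k%:Z - j%:Z) = 0); last by lia.
    by rewrite (extend_first bw'); apply; lia.
  have := block_no11 (n := (j - k).-1) bw; rewrite a1 a2 => h.
  by suff : false by []; apply: h; lia.
move: ne agree; rewrite jk => ne agree.
have agree' n : (n <= size w)%N -> (n <= size w')%N -> nth true w n = nth true w' n.
  move=> h1 h2; have := agree (Posz n); rewrite subrr addr0 !mem_window.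
  by apply; lia.
have szw := block_size bw; have szw' := block_size bw'.
(* Likewise for the 11 at the end of the shorter one. *)
have sww' : size w = size w'.
  case: (ltngtP (size w) (size w')) => // h; exfalso.
    have := block_no11 (n := (size w).-1) bw'.
    rewrite prednK // => /(_ h); rewrite -!agree' ?(extend_last bw) ?extend_beyond //; lia.
  have := block_no11 (n := (size w').-1) bw.
  rewrite prednK // => /(_ h); rewrite !agree' ?(extend_last bw') ?extend_beyond //; lia.
move/eqP: ne; apply; congr (_, _); apply: (@eq_from_nth _ true) => // n nw.
by apply: agree'; lia.
Qed.

End BlockWords.

Section MatrixUnits.
Variables (A : algType rat) (L : shift_frame A).
Implicit Types (w : seq bool) (a b : bool).
Local Notation star := (fstar L).
Local Notation tr := (ftr L).
Local Notation t := (ft L).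
Local Notation e := (fe L).

Definition block_cyl w : A := cylinder e (extend w) (window w).

(** Matrix unit from the [j]-th to the [i]-th letter of an occurrence of the
    block [w]. *)
Definition munit w (i j : nat) : A := t i%:Z * block_cyl w * t (- j%:Z).

Lemma star_munit w i j : star (munit w i j) = munit w j i.
Proof.
by rewrite /munit !fstarM !fstar_t star_cylinder opprK mulrA.
Qed.

(** Two occurrences of blocks that share a letter coincide, so the cylinders of
    incompatible positions are disjoint. *)
Lemma munitM w w' i j k m : is_block w -> is_block w' ->
  (j < size w)%N -> (k < size w')%N ->
  munit w i j * munit w' k m = if (w == w') && (j == k) then munit w i m else 0.
Proof.
move=> bw bw' jw kw'.
have -> : munit w i j * munit w' k m =
    t i%:Z * (block_cyl w * t (k%:Z - j%:Z) * block_cyl w') * t (- m%:Z).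
  rewrite /munit -!mulrA; congr (_ * (_ * _)).
  by rewrite !mulrA ftD addrC.
case: ifPn => [/andP[/eqP <- /eqP <-]|]; first by rewrite subrr ft0 mulr1 cylinder_idem.
rewrite -[_ && _]/((w, j) == (w', k)) => ne.
have [s [sw sw' ss']] := block_conflict bw bw' jw kw' ne.
suff -> : block_cyl w * t (k%:Z - j%:Z) * block_cyl w' = 0 by rewrite mulr0 mul0r.
rewrite /block_cyl -mulrA shift_cylinder mulrA (@cylinder_conflict _ L _ _ _ _ s) ?mul0r //.
by apply/mapP; exists (s + (k%:Z - j%:Z)) => //; rewrite addrK.
Qed.

Lemma tr_munit w i j : tr (munit w i j) = (i == j)%:R * 2^-1 ^+ (size w).+2.
Proof.
rewrite /munit ftr_cylinder ?uniq_window // size_window subr_eq0 eqz_nat.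
by case: (i == j); rewrite ?mul1r ?mul0r.
Qed.

Lemma tM_munit (n : int) w i j :
  t n * munit w i j = t (n + i%:Z) * block_cyl w * t (- j%:Z).
Proof. by rewrite /munit !mulrA ftD. Qed.

(** For [a], [b] not both 1, these are the three generators of the algebra: a step
    across two adjacent letters [a], [b]. *)
Definition step a b : A := e (-1) a * e 0 b * t 1.

Lemma ft_eC n i b : e i b * t n = t n * e (i + n) b.
Proof. by rewrite ft_e addrK. Qed.

(** From the last letter of a block the step would lead across 11. Then the index
    [i.+1] falls on the 1 that follows the block. *)
Lemma step_munit a b w i j : is_block w -> (i < size w)%N ->
  step a b * munit w i j =
  if (nth true w i == a) && (nth true w i.+1 == b) then munit w i.+1 j else 0.
Proof.
move=> bw iw; rewrite /step -mulrA tM_munit !mulrA -![_ * e _ _ * t _]mulrA !ft_eC.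
rewrite -!mulrA [e (-1) a * _]mulrA ft_eC -!mulrA.
rewrite (mulrA (e _ b)) (@idem_cylinder _ L); last by rewrite mem_window; lia.
rewrite (_ : 0 + (1 + i%:Z) = Posz i.+1); last by lia.
rewrite (_ : -1 + (1 + i%:Z) = Posz i); last by lia.
rewrite /= ![_ == b]eq_sym [_ == a]eq_sym.
case: (b == _); last by rewrite andbF mul0r !mulr0.
rewrite (mulrA (e _ a)) (@idem_cylinder _ L); last by rewrite mem_window; lia.
rewrite /= andbT; case: (a == _); last by rewrite mul0r !mulr0.
by rewrite /munit mulrA (_ : 1 + i%:Z = i.+1%:Z) //; lia.
Qed.

Lemma star_step_munit a b w i j : is_block w -> (i < size w)%N -> ~~ (a && b) ->
  star (step a b) * munit w i j =
  if [&& (0 < i)%N, nth true w i.-1 == a & nth true w i == b]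
  then munit w i.-1 j else 0.
Proof.
move=> bw iw ab; rewrite /step !fstarM fstar_t !fstar_e -!mulrA.
rewrite /munit (mulrA (e (-1) a)) (mulrA (e (-1) a)) ft_eC.
rewrite -!mulrA (mulrA (e 0 b)) ft_eC -!mulrA mulrA ftD.
rewrite (mulrA (e _ a)) (@idem_cylinder _ L); last by rewrite mem_window; lia.
case: i iw => [|i] iw.
  rewrite addr0 /=; case: eqP => [aE|_]; last by rewrite mul0r !mulr0.
  rewrite (mulrA (e _ b)) (@idem_cylinder _ L); last by rewrite mem_window; lia.
  rewrite -[0 + 0]/(Posz 0) (extend_first bw).
  case: eqP => [bE|_]; last by rewrite mul0r !mulr0.
  by rewrite aE bE in ab.
have -> : -1 + i.+1%:Z = Posz i by lia.
rewrite -[extend w (Posz i)]/(nth true w i) [a == _]eq_sym add0r.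
rewrite ltn0Sn -[i.+1.-1]/i andTb.
case: (nth true w i == a); last by rewrite mul0r !mulr0.
rewrite (mulrA (e _ b)) (@idem_cylinder _ L); last by rewrite mem_window; lia.
rewrite /= [b == _]eq_sym; case: (_ == b); last by rewrite mul0r !mulr0.
by rewrite !mulrA.
Qed.

End MatrixUnits.

Section BlockAction.
Variables (A : algType rat) (L : shift_frame A).
Implicit Types (w : seq bool) (g : A).
Local Notation star := (fstar L).
Local Notation tr := (ftr L).
Local Notation E := (munit L).

Lemma fstar0 : star 0 = 0.
Proof. by rewrite -[X in star X](scale0r (0 : A)) fstarZ scale0r. Qed.

Lemma fstar_sum I (r : seq I) (F : I -> A) :
  star (\sum_(i <- r) F i) = \sum_(i <- r) star (F i).
Proof. exact: (big_morph _ (fstarD L) fstar0). Qed.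

Lemma ftr_sum I (r : seq I) (F : I -> A) :
  tr (\sum_(i <- r) F i) = \sum_(i <- r) tr (F i).
Proof.
apply: (big_morph _ (ftrD L)).
by rewrite -[X in tr X](scale0r (0 : A)) ftrZ mul0r.
Qed.

Definition acts_left w g (X : 'M[rat]_(size w)) := forall i j : 'I_(size w),
  g * E w i j = \sum_k X k i *: E w k j.

(** Over the block [w], the element [g] is the matrix [X]. The condition on the
    adjoint yields the multiplication on the right ([acts_right]). *)
Definition acts w g (X : 'M[rat]_(size w)) :=
  acts_left g X /\ acts_left (star g) X^T.

Lemma acts_star w g (X : 'M[rat]_(size w)) : acts g X -> acts (star g) X^T.
Proof. by case=> h1 h2; split=> //; rewrite fstarK trmxK. Qed.

Lemma acts_left1 w : acts_left 1 (1%:M : 'M[rat]_(size w)).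
Proof.
move=> i j; rewrite mul1r (bigD1 i) //= mxE eqxx scale1r big1 ?addr0 // => k ki.
by rewrite mxE (negbTE ki) scale0r.
Qed.

Lemma acts1 w : acts 1 (1%:M : 'M[rat]_(size w)).
Proof. by split; rewrite ?fstar1 ?trmx1; exact: acts_left1. Qed.

Lemma acts_leftD w g g' (X Y : 'M[rat]_(size w)) :
  acts_left g X -> acts_left g' Y -> acts_left (g + g') (X + Y).
Proof.
move=> hX hY i j; rewrite mulrDl hX hY -big_split; apply: eq_bigr => k _.
by rewrite mxE scalerDl.
Qed.

Lemma actsD w g g' (X Y : 'M[rat]_(size w)) :
  acts g X -> acts g' Y -> acts (g + g') (X + Y).
Proof.
move=> [h1 h2] [h3 h4]; split; first exact: acts_leftD.
by rewrite fstarD linearD; exact: acts_leftD.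
Qed.

Lemma acts_leftZ w q g (X : 'M[rat]_(size w)) :
  acts_left g X -> acts_left (q *: g) (q *: X).
Proof.
move=> hX i j; rewrite -scalerAl hX scaler_sumr; apply: eq_bigr => k _.
by rewrite mxE scalerA.
Qed.

Lemma actsZ w q g (X : 'M[rat]_(size w)) : acts g X -> acts (q *: g) (q *: X).
Proof.
move=> [h1 h2]; split; first exact: acts_leftZ.
by rewrite fstarZ linearZ; exact: acts_leftZ.
Qed.

Lemma actsB w g g' (X Y : 'M[rat]_(size w)) :
  acts g X -> acts g' Y -> acts (g - g') (X - Y).
Proof.
by move=> h1 h2; rewrite -scaleN1r -(scaleN1r Y); apply: actsD => //; exact: actsZ.
Qed.

Lemma acts_leftM w g g' (X Y : 'M[rat]_(size w)) :
  acts_left g X -> acts_left g' Y -> acts_left (g * g') (X *m Y).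
Proof.
move=> hX hY i j; rewrite -mulrA hY mulr_sumr.
under eq_bigr => k _ do rewrite -scalerAr hX scaler_sumr.
rewrite exchange_big; apply: eq_bigr => k _ /=.
rewrite mxE scaler_suml; apply: eq_bigr => l _.
by rewrite scalerA mulrC.
Qed.

Lemma actsM w g g' (X Y : 'M[rat]_(size w)) :
  acts g X -> acts g' Y -> acts (g * g') (X *m Y).
Proof.
move=> [h1 h2] [h3 h4]; split; first exact: acts_leftM.
by rewrite fstarM trmx_mul; exact: acts_leftM.
Qed.

Lemma acts_right w g (X : 'M[rat]_(size w)) : acts g X -> forall i j : 'I_(size w),
  E w i j * g = \sum_k X j k *: E w i k.
Proof.
move=> [_ hX] i j; rewrite -[LHS](fstarK L) fstarM star_munit hX fstar_sum.
by apply: eq_bigr => k _; rewrite fstarZ star_munit mxE.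
Qed.

Definition step_mx w (a b : bool) : 'M[rat]_(size w) :=
  \matrix_(k, i) ((k == i.+1 :> nat) && (nth true w i == a) && (nth true w k == b))%:R.

(** The exclusion of the pair 11 keeps the step inside the block at its ends. *)
Lemma acts_step w a b : is_block w -> ~~ (a && b) -> acts (step L a b) (step_mx w a b).
Proof.
move=> bw ab; split=> i j.
  rewrite step_munit //.
  have [iw|wi] := ltnP i.+1 (size w); last first.
    have il : i = (size w).-1 :> nat by have := ltn_ord i; lia.
    rewrite big1 => [|k _]; last first.
      by rewrite mxE (_ : (_ == _) = false) ?scale0r //; have := ltn_ord k; lia.
    case: ifP => // /andP[/eqP ia /eqP ib].
    by rewrite -ia -ib il extend_last // extend_beyond // in ab; have := ltn_ord i; lia.
  rewrite (bigD1 (Ordinal iw)) //= big1 => [|k ki]; last first.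
    rewrite mxE (_ : (_ == _ :> nat) = false) ?scale0r //.
    by apply: contraNF ki => /eqP ki; apply/eqP/val_inj.
  rewrite addr0 mxE eqxx andTb /=.
  by case: ifP; rewrite ?scale1r ?scale0r.
rewrite star_step_munit //.
case: i => [[|i] iw].
  rewrite ltnn /= big1 // => k _.
  by rewrite !mxE /= scale0r.
have iw' : (i < size w)%N by rewrite ltnW.
rewrite (bigD1 (Ordinal iw')) //= big1 => [|k ki]; last first.
  rewrite !mxE (_ : (_ == _ :> nat) = false) ?scale0r //=.
  by apply: contraNF ki; rewrite eqSS => /eqP ki; apply/eqP/val_inj.
rewrite addr0 !mxE eqxx andTb /=.
by case: ifP; rewrite ?scale1r ?scale0r.
Qed.

Variable k : nat.
Definition bindex w := ('I_(size w) * 'I_k)%type.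
Implicit Types (X Y : forall w, bindex w -> bindex w -> rat).

Definition bmul w (X Y : bindex w -> bindex w -> rat) s t := \sum_r X s r * Y r t.
Definition btr w (X : bindex w -> bindex w -> rat) s t := X t s.

Lemma bmulE w (X Y : bindex w -> bindex w -> rat) s t :
  bmul X Y s t = \sum_i \sum_c X s (i, c) * Y (i, c) t.
Proof. by rewrite pair_bigA; apply: eq_bigr => -[]. Qed.

(** The embedding of the matrices over [w], with entries indexed by a letter and a
    coordinate, into the matrices over the algebra. *)
Definition block_emb w (X : bindex w -> bindex w -> rat) : 'M[A]_k :=
  \matrix_(a, b) \sum_i \sum_j X (i, a) (j, b) *: E w i j.

Lemma block_embM w (X Y : bindex w -> bindex w -> rat) : is_block w ->
  block_emb X *m block_emb Y = block_emb (bmul X Y).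
Proof.
move=> bw; apply/matrixP => a b; rewrite !mxE.
transitivity (\sum_c \sum_i \sum_j \sum_m
    (X (i, a) (j, c) * Y (j, c) (m, b)) *: E w i m).
  apply: eq_bigr => c _; rewrite !mxE mulr_suml; apply: eq_bigr => i _.
  rewrite mulr_suml; apply: eq_bigr => j _; rewrite mulr_sumr (bigD1 j) //=.
  rewrite [X in _ + X]big1 ?addr0 => [|l lj]; last first.
    rewrite mulr_sumr big1 // => m _; rewrite -scalerAl -scalerAr munitM //.
    by rewrite eqxx eq_sym (inj_eq val_inj) (negbTE lj) !scaler0.
  rewrite mulr_sumr; apply: eq_bigr => m _; rewrite -scalerAl -scalerAr munitM //.
  by rewrite !eqxx scalerA.
rewrite exchange_big; apply: eq_bigr => i _ /=.
under eq_bigr => c _ do rewrite exchange_big /=.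
rewrite exchange_big; apply: eq_bigr => m _ /=.
rewrite bmulE exchange_big scaler_suml; apply: eq_bigr => j _ /=.
by rewrite scaler_suml.
Qed.

Lemma block_embM_neq w w' (X : bindex w -> bindex w -> rat)
    (Y : bindex w' -> bindex w' -> rat) : is_block w -> is_block w' -> w != w' ->
  block_emb X *m block_emb Y = 0.
Proof.
move=> bw bw' ww'; apply/matrixP => a b; rewrite !mxE big1 // => c _; rewrite !mxE.
rewrite mulr_suml big1 // => i _; rewrite mulr_suml big1 // => j _.
rewrite mulr_sumr big1 // => l _; rewrite mulr_sumr big1 // => m _.
by rewrite -scalerAl -scalerAr munitM // (negbTE ww') !scaler0.
Qed.

Lemma star_block_emb w (X : bindex w -> bindex w -> rat) a b :
  star (block_emb X a b) = block_emb (btr X) b a.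
Proof.
rewrite !mxE fstar_sum.
under eq_bigr => i _ do rewrite fstar_sum.
rewrite exchange_big; apply: eq_bigr => j _; apply: eq_bigr => i _ /=.
by rewrite fstarZ star_munit.
Qed.

Lemma tr_block_emb w (X : bindex w -> bindex w -> rat) a :
  tr (block_emb X a a) = 2^-1 ^+ (size w).+2 * \sum_i X (i, a) (i, a).
Proof.
rewrite mxE ftr_sum mulr_sumr; apply: eq_bigr => i _.
rewrite ftr_sum (bigD1 i) //= big1 => [|j ji]; last first.
  by rewrite ftrZ tr_munit eq_sym (inj_eq val_inj) (negbTE ji) mul0r mulr0.
by rewrite addr0 ftrZ tr_munit eqxx mul1r mulrC.
Qed.

Lemma block_embB w (X Y : bindex w -> bindex w -> rat) :
  block_emb X - block_emb Y = block_emb (fun s t => X s t - Y s t).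
Proof.
apply/matrixP => a b; rewrite !mxE -sumrB; apply: eq_bigr => i _.
by rewrite -sumrB; apply: eq_bigr => j _; rewrite scalerBl.
Qed.

Lemma eq_block_emb w (X Y : bindex w -> bindex w -> rat) :
  (forall s t, X s t = Y s t) -> block_emb X = block_emb Y.
Proof.
move=> XY; apply/matrixP => a b; rewrite !mxE; apply: eq_bigr => i _.
by apply: eq_bigr => j _; rewrite XY.
Qed.

Definition bmx w (Aw : 'I_k -> 'I_k -> 'M[rat]_(size w)) (s t : bindex w) :=
  Aw s.2 t.2 s.1 t.1.

Lemma acts_block_emb w (M : 'M[A]_k) Aw (X : bindex w -> bindex w -> rat) :
  (forall a b, acts (M a b) (Aw a b)) ->
  M *m block_emb X = block_emb (bmul (bmx Aw) X).
Proof.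
move=> hM; apply/matrixP => a b; rewrite !mxE.
transitivity (\sum_c \sum_i \sum_j \sum_l
    (Aw a c l i * X (i, c) (j, b)) *: E w l j).
  apply: eq_bigr => c _; rewrite !mxE mulr_sumr; apply: eq_bigr => i _.
  rewrite mulr_sumr; apply: eq_bigr => j _.
  rewrite -scalerAr (hM a c).1 scaler_sumr; apply: eq_bigr => l _.
  by rewrite scalerA mulrC.
under eq_bigr => c _.
  under eq_bigr => i _ do rewrite exchange_big /=.
  rewrite exchange_big /=; over.
rewrite exchange_big; apply: eq_bigr => l _ /=.
under eq_bigr => c _ do rewrite exchange_big /=.
rewrite exchange_big; apply: eq_bigr => j _ /=.
rewrite bmulE exchange_big scaler_suml; apply: eq_bigr => i _ /=.
by rewrite scaler_suml.
Qed.

Lemma block_emb_acts w (M : 'M[A]_k) Aw (X : bindex w -> bindex w -> rat) :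
  (forall a b, acts (M a b) (Aw a b)) ->
  block_emb X *m M = block_emb (bmul X (bmx Aw)).
Proof.
move=> hM; apply/matrixP => a b; rewrite !mxE.
transitivity (\sum_c \sum_i \sum_j \sum_l
    (X (i, a) (j, c) * Aw c b j l) *: E w i l).
  apply: eq_bigr => c _; rewrite !mxE mulr_suml; apply: eq_bigr => i _.
  rewrite mulr_suml; apply: eq_bigr => j _.
  rewrite -scalerAl (acts_right (hM c b)) scaler_sumr; apply: eq_bigr => l _.
  by rewrite scalerA.
rewrite exchange_big; apply: eq_bigr => i _ /=.
under eq_bigr => c _ do rewrite exchange_big /=.
rewrite exchange_big; apply: eq_bigr => l _ /=.
rewrite bmulE exchange_big scaler_suml; apply: eq_bigr => j _ /=.
by rewrite scaler_suml.
Qed.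

End BlockAction.

(** * The mass of the blocks *)

Section CountingBlocks.

(** A nonempty tail starts with the letter 0; what follows is either 1 and a
    shorter tail, or again a nonempty tail. *)
Fixpoint tails n : seq (seq bool) :=
  match n with
  | 0 => [:: [::]]
  | 1 => [::]
  | (m.+1 as p).+1 => [seq [:: false, true & t] | t <- tails m] ++
                      [seq false :: t | t <- tails p]
  end.

Lemma tailsSS n : tails n.+2 = [seq [:: false, true & t] | t <- tails n] ++
                               [seq false :: t | t <- tails n.+1].
Proof. by []. Qed.

Lemma mem_tails n t : (t \in tails n) = is_tail t && (size t == n).
Proof.
elim/ltn_ind: n t => -[|[|n]] IHn t.
- by case: t => [|b t]; rewrite // inE andbF.
- by case: t => [|[] [|c t]] //=; rewrite andbF.
rewrite tailsSS mem_cat.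
have hinj1 : injective (fun t : seq bool => [:: false, true & t]) by move=> ? ? [].
have hinj2 : injective (cons false) by move=> ? ? [].
case: t => [|[] t].
- rewrite andbF; apply/negbTE; rewrite negb_or.
  by apply/andP; split; apply/mapP => -[].
- by apply/negbTE; rewrite negb_or; apply/andP; split; apply/mapP => -[].
rewrite [X in _ || X](mem_map hinj2) IHn // eqSS.
case: t => [|[] t].
- by apply/negbTE; rewrite negb_or andbT; apply/mapP => -[].
- by rewrite (mem_map hinj1) IHn // [X in _ || X]andFb orbF.
rewrite (_ : (_ \in [seq _ | _ <- tails n]) = false) //.
by apply/negbTE/mapP => -[].
Qed.

Lemma uniq_tails n : uniq (tails n).
Proof.
elim/ltn_ind: n => -[|[|n]] IHn //.
rewrite tailsSS cat_uniq !map_inj_uniq; try by move=> ? ? [].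
rewrite !IHn // andTb andbT; apply/hasPn => _ /mapP[t ht ->].
apply/negP => /mapP[t' _ [tt']]; move: ht; rewrite tt' mem_tails.
by rewrite /is_tail.
Qed.

Definition blocks N : seq (seq bool) :=
  flatten [seq [seq true :: t | t <- tails m] | m <- iota 0 N].

Lemma mem_blocks N w : (w \in blocks N) = is_block w && (size w <= N)%N.
Proof.
apply/flatten_mapP/andP => [[m]|[bw wN]].
  rewrite mem_iota => /= mN /mapP[t]; rewrite mem_tails => /andP[ht /eqP sz] ->.
  by rewrite /= sz.
case: w bw wN => // -[] // t /= ht tN; exists (size t); first by rewrite mem_iota.
by apply/map_f; rewrite mem_tails ht eqxx.
Qed.

Lemma sum_blocks (V : nmodType) N (F : seq bool -> V) :
  \sum_(w <- blocks N) F w = \sum_(m < N) \sum_(t <- tails m) F (true :: t).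
Proof.
rewrite /blocks big_flatten big_map -[N in iota 0 N]subn0 big_mkord.
by apply: eq_bigr => m _; rewrite big_map.
Qed.

Lemma uniq_blocks N : uniq (blocks N).
Proof.
apply/allpairs_uniq_dep => //; first exact: iota_uniq.
- by move=> m _; exact: uniq_tails.
move=> [m t] [m' t'] /allpairsPdep[m1 [t1 [_ h1 [-> ->]]]].
move=> /allpairsPdep[m2 [t2 [_ h2 [-> ->]]]] /= [tt].
move: h1 h2; rewrite tt !mem_tails => /andP[_ /eqP e1] /andP[_ /eqP e2].
by rewrite -e1 -e2.
Qed.

Definition ntails n : nat := size (tails n).

Lemma ntailsSS n : ntails n.+2 = (ntails n + ntails n.+1)%N.
Proof. by rewrite /ntails tailsSS size_cat !size_map. Qed.

(** Total mass of the blocks of size at most [N]: a block of size [l] occupies [l]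
    letters and prescribes [l + 2] of them. *)
Definition block_mass N : rat :=
  \sum_(w <- blocks N) (size w)%:R * 2^-1 ^+ (size w).+2.

Lemma block_massS N :
  block_mass N.+1 = block_mass N + (ntails N * N.+1)%:R * 2^-1 ^+ N.+3.
Proof.
rewrite /block_mass !sum_blocks big_ord_recr /=; congr (_ + _).
rewrite (eq_big_seq (fun=> N.+1%:R * 2^-1 ^+ N.+3)) => [|t].
  by rewrite big_const_seq count_predT iter_addr_0 -/(ntails N) natrM -mulrA [RHS]mulr_natl.
by rewrite mem_tails => /andP[_ /eqP ->].
Qed.

(** Since [ntails] satisfies the Fibonacci recurrence, the remaining mass has this
    closed form, with the coefficients determined by [block_massS]. *)
Lemma block_massE N : block_mass N = 1 - 2^-1 ^+ N *
  ((N%:R / 4 + 1) * (ntails N)%:R + (N%:R / 4 + 3 / 2) * (ntails N.+1)%:R).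
Proof.
elim: N => [|N IHN]; first by rewrite /block_mass big_nil /ntails /=; field.
rewrite block_massS IHN ntailsSS natrM natrD !exprS -!natr1.
by field.
Qed.

Lemma ntails_le N : (ntails N)%:R <= (7 / 4) ^+ N :> rat.
Proof.
elim/ltn_ind: N => -[|[|N]] IHN; [by rewrite expr0|by rewrite exprn_ge0|].
rewrite ntailsSS natrD; have h0 := IHN N (ltnW (ltnSn _)).
have h1 := IHN N.+1 (ltnSn _).
apply: le_trans (lerD h0 h1) _; rewrite !exprS.
have : 0 <= (7 / 4) ^+ N :> rat by rewrite exprn_ge0.
by set z := _ ^+ N; lra.
Qed.

Lemma mass_tail_le (F : realFieldType) (p u z a b x : F) :
  0 <= p -> 0 <= z -> 0 <= x -> a <= z -> b <= 7 / 4 * z -> x + 16 <= 16 * u ->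
  p * ((x / 4 + 1) * a + (x / 4 + 3 / 2) * b) <= 44 * (p * (u * z)).
Proof.
move=> p0 z0 x0 az bz xu; rewrite [leRHS]mulrCA ler_wpM2l //.
apply: (@le_trans _ _ ((x / 4 + 1) * z + (x / 4 + 3 / 2) * (7 / 4 * z))).
  by apply: lerD; apply: ler_wpM2l => //; lra.
have : (x + 16) * z <= 16 * u * z by rewrite ler_wpM2r.
have : 0 <= x * z by rewrite mulr_ge0.
lra.
Qed.

(** As [ntails] grows at most like [(7/4)^N], the remaining mass is at most of order
    [N (7/8)^N], and the linear factor is absorbed by [(17/16)^N]. *)
Lemma block_mass_tail N : 1 - 44 * (119 / 128) ^+ N <= block_mass N <= 1.
Proof.
have p0 : 0 <= 2^-1 ^+ N :> rat by rewrite exprn_ge0.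
have n0 : 0 <= N%:R :> rat by rewrite ler0n.
have c0 : 0 <= (ntails N)%:R :> rat by rewrite ler0n.
have c1 : 0 <= (ntails N.+1)%:R :> rat by rewrite ler0n.
rewrite block_massE gerBl; apply/andP; split; last first.
  by rewrite mulr_ge0 // addr_ge0 // mulr_ge0 //; lra.
rewrite lerD2l lerN2.
have h0 := ntails_le N; have h1 := ntails_le N.+1; rewrite exprS in h1.
have bern : N%:R + 16 <= 16 * (17 / 16) ^+ N :> rat.
  elim: N {p0 n0 c0 c1 h0 h1} => [|N IHN]; first by rewrite expr0; lra.
  by rewrite exprS -natr1; have : 0 <= N%:R :> rat by []; lra.
have E : (119 / 128) ^+ N = 2^-1 ^+ N * ((17 / 16) ^+ N * (7 / 4) ^+ N) :> rat.
  have -> : 119 / 128 = 2^-1 * (17 / 16 * (7 / 4)) :> rat by field.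
  by rewrite !exprMn.
rewrite E; apply: mass_tail_le => //; exact: exprn_ge0.
Qed.

End CountingBlocks.

(** * Transfer operators *)

Section FiniteLinearAlgebra.

(** Every column of a cokernel of [M] lies in the kernel of [M], hence is killed
    by [1 - q]; so the rows of [1 - q] are in the row space of [M]. *)
Lemma compl_factor (T : finType) (M q : T -> T -> rat) :
  (forall u : T -> rat, (forall s, \sum_t M s t * u t = 0) ->
     forall s, \sum_t q s t * u t = u s) ->
  exists B : T -> T -> rat, forall s t, (s == t)%:R - q s t = \sum_r B s r * M r t.
Proof.
move=> hq.
pose mx (X : T -> T -> rat) : 'M[rat]_#|T| := \matrix_(i, j) X (enum_val i) (enum_val j).
have : (1%:M - mx q <= mx M)%MS.
  rewrite submxE; move: (cokermx _) (mulmx_coker (mx M)) => N MN.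
  suff -> : (1%:M - mx q) *m N = 0 by [].
  rewrite mulmxBl mul1mx (_ : mx q *m N = N) ?subrr //; apply/matrixP => i j.
  pose u t := N (enum_rank t) j.
  have sumE (X : T -> T -> rat) s : \sum_t X s t * u t = (mx X *m N) (enum_rank s) j.
    rewrite mxE (reindex _ (onW_bij _ (@enum_val_bij T))) /=.
    by apply: eq_bigr => l _; rewrite mxE enum_rankK /u enum_valK.
  rewrite -{1}(enum_valK i) -sumE hq => [|s]; first by rewrite /u enum_valK.
  by rewrite sumE MN mxE.
move=> /submxP[D DE].
exists (fun s t => D (enum_rank s) (enum_rank t)) => s t.
have := congr1 (fun X : 'M[rat]_#|T| => X (enum_rank s) (enum_rank t)) DE.
rewrite /mx !mxE !enum_rankK (inj_eq enum_rank_inj) => ->.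
rewrite (reindex _ (onW_bij _ (@enum_val_bij T))) /=.
by apply: eq_bigr => l _; rewrite mxE enum_rankK enum_valK.
Qed.

End FiniteLinearAlgebra.

Section TransferOperator.
Variables (A : algType rat) (L : shift_frame A) (K : nat).
Variables (J C0 C1 Cs Ce : 'M[rat]_K).
Implicit Types (w : seq bool).
Local Notation star := (fstar L).

(** These steps arrive at the letter 0, at the letter 1, and at any letter. *)
Definition step0 : A := step L false false + step L true false.
Definition step1 : A := step L false true.
Definition step01 : A := step0 + step1.

(** No step arrives at the first letter of a block, and none leaves the last. *)
Definition first_proj : A := 1 - step01 * star step01.
Definition last_proj : A := 1 - star step01 * step01.

(** An equation between vectors attached to the letters of a block: [C0] and [C1]
    transport the vector of a letter to the next letter, which is 0 or 1; [Cs] acts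
    at the first letter and [Ce] at the last. *)
Definition transfer_op : 'M[A]_K := \matrix_(a, b)
  (J a b *: 1 - C0 a b *: step0 - C1 a b *: step1 - Cs a b *: first_proj
   + Ce a b *: last_proj).

Definition shift_mx w (c : pred bool) : 'M[rat]_(size w) :=
  \matrix_(k, i) ((k == i.+1 :> nat) && c (nth true w k))%:R.

Lemma acts_step0 w : is_block w -> acts L step0 (shift_mx w negb).
Proof.
move=> bw; have := actsD (acts_step L bw (isT : ~~ (false && false)))
  (acts_step L bw (isT : ~~ (true && false))).
congr acts; apply/matrixP => k i; rewrite !mxE.
by case: eqP; case: (nth true w i); case: (nth true w k); rewrite ?addr0 ?add0r.
Qed.

Lemma acts_step1 w : is_block w -> acts L step1 (shift_mx w id).
Proof.
move=> bw; have := acts_step L bw (isT : ~~ (false && true)).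
congr acts; apply/matrixP => k i; rewrite !mxE.
case: eqP => //= ki; have := @block_no11 w i bw; rewrite -ki ltn_ord => /(_ isT).
by case: (nth true w i); case: (nth true w k).
Qed.

Lemma acts_step01 w : is_block w -> acts L step01 (shift_mx w predT).
Proof.
move=> bw; have := actsD (acts_step0 bw) (acts_step1 bw).
congr acts; apply/matrixP => k i; rewrite !mxE andbT.
by case: eqP; case: (nth true w k); rewrite ?addr0 ?add0r.
Qed.

Definition place_mx w (n : nat) : 'M[rat]_(size w) :=
  \matrix_(k, i) ((k == i) && (k == n :> nat))%:R.

Lemma acts_first_proj w : is_block w -> acts L first_proj (place_mx w 0).
Proof.
move=> bw; have := actsB (acts1 L w) (actsM (acts_step01 bw) (acts_star (acts_step01 bw))).
congr acts; apply/matrixP => k i; rewrite !mxE.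
case: k => [[|k] hk].
  rewrite big1 ?subr0 ?andbT // => l _; rewrite !mxE /=.
  by rewrite mul0r.
rewrite (bigD1 (Ordinal (ltnW hk))) //= big1 => [|l lk]; last first.
  rewrite !mxE (_ : (_ == _ :> nat) = false) ?mul0r //=.
  by apply: contraNF lk; rewrite eqSS => /eqP lk; apply/eqP/val_inj.
rewrite addr0 !mxE !andbT eqxx mul1r andbF -val_eqE /= [k.+1 == _]eq_sym.
by rewrite subrr.
Qed.

Lemma acts_last_proj w : is_block w -> acts L last_proj (place_mx w (size w).-1).
Proof.
move=> bw; have := actsB (acts1 L w) (actsM (acts_star (acts_step01 bw)) (acts_step01 bw)).
congr acts; apply/matrixP => k i; rewrite !mxE.
have [kw|wk] := ltnP k.+1 (size w); last first.
  have kl : k = (size w).-1 :> nat by have := ltn_ord k; lia.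
  rewrite kl eqxx andbT big1 ?subr0 // => l _; rewrite !mxE.
  by rewrite (_ : (_ == _ :> nat) = false) ?mul0r //; have := ltn_ord l; lia.
rewrite (bigD1 (Ordinal kw)) //= big1 => [|l lk]; last first.
  rewrite !mxE (_ : (_ == _ :> nat) = false) ?mul0r //=.
  by apply: contraNF lk => /eqP lk; apply/eqP/val_inj.
rewrite addr0 !mxE !andbT eqxx mul1r eqSS -val_eqE /= subrr.
by rewrite (_ : (_ == _.-1 :> nat) = false) ?andbF //; lia.
Qed.

Definition transfer_mx w (a b : 'I_K) : 'M[rat]_(size w) :=
  J a b *: 1%:M - C0 a b *: shift_mx w negb - C1 a b *: shift_mx w id
  - Cs a b *: place_mx w 0 + Ce a b *: place_mx w (size w).-1.

Lemma acts_transfer w a b : is_block w -> acts L (transfer_op a b) (transfer_mx w a b).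
Proof.
move=> bw; rewrite mxE; apply: actsD; last exact/actsZ/acts_last_proj.
apply: actsB; last exact/actsZ/acts_first_proj.
apply: actsB; last exact/actsZ/acts_step1.
apply: actsB; last exact/actsZ/acts_step0.
exact/actsZ/acts1.
Qed.

Definition transfer_val w (u : nat -> 'cV[rat]_K) (n : nat) : 'cV[rat]_K :=
  J *m u n - (if (0 < n)%N then (if nth true w n then C1 else C0) *m u n.-1 else 0)
  - (if n == 0%N then Cs *m u n else 0)
  + (if n == (size w).-1 then Ce *m u n else 0).

Lemma sum_shift_mx w c k (f : nat -> rat) :
  \sum_i shift_mx w c k i * f i =
  if (0 < k)%N && c (nth true w k) then f k.-1 else 0.
Proof.
case: k => [[|k] hk].
  by rewrite big1 // => i _; rewrite mxE mul0r.
rewrite (bigD1 (Ordinal (ltnW hk))) //= big1 => [|l lk]; last first.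
  rewrite !mxE (_ : (_ == _ :> nat) = false) ?mul0r //=.
  by apply: contraNF lk; rewrite eqSS => /eqP lk; apply/eqP/val_inj.
by rewrite addr0 mxE eqxx /=; case: c; rewrite ?mul1r ?mul0r.
Qed.

Lemma sum_place_mx w n k (f : nat -> rat) :
  \sum_i place_mx w n k i * f i = if k == n :> nat then f k else 0.
Proof.
rewrite (bigD1 k) //= big1 => [|l lk]; last first.
  by rewrite mxE eq_sym (negbTE lk) mul0r.
by rewrite addr0 mxE eqxx /=; case: eqP; rewrite ?mul1r ?mul0r.
Qed.

Lemma transfer_valE w (u : nat -> 'cV[rat]_K) (k : 'I_(size w)) a :
  \sum_(t : bindex K w) bmx (transfer_mx w) (k, a) t * u t.1 t.2 0 =
  transfer_val w u k a 0.
Proof.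
rewrite -(pair_bigA _ (fun i b => bmx (transfer_mx w) (k, a) (i, b) * u i b 0)) /=.
rewrite exchange_big /=.
have sum1 (f : 'I_(size w) -> rat) : \sum_i (1%:M : 'M[rat]_(size w)) k i * f i = f k.
  rewrite (bigD1 k) //= big1 ?addr0 ?mxE ?eqxx ?mul1r // => l lk.
  by rewrite mxE eq_sym (negbTE lk) mul0r.
have lin_comb_mxE (X1 X2 X3 X4 X5 : 'M[rat]_(size w)) c1 c2 c3 c4 c5 i :
    (c1 *: X1 - c2 *: X2 - c3 *: X3 - c4 *: X4 + c5 *: X5) k i =
    c1 * X1 k i - c2 * X2 k i - c3 * X3 k i - c4 * X4 k i + c5 * X5 k i.
  by rewrite !mxE.
transitivity (\sum_b
   (J a b * u k b 0
    - (if (0 < k)%N then (if nth true w k then C1 else C0) a b * u k.-1 b 0 else 0)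
    - (if k == 0%N :> nat then Cs a b * u k b 0 else 0)
    + (if k == (size w).-1 :> nat then Ce a b * u k b 0 else 0))).
  apply: eq_bigr => b _; rewrite /bmx /transfer_mx.
  transitivity (\sum_i (J a b * ((1%:M : 'M[rat]_(size w)) k i * u i b 0)
     - C0 a b * (shift_mx w negb k i * u i b 0) - C1 a b * (shift_mx w id k i * u i b 0)
     - Cs a b * (place_mx w 0 k i * u i b 0)
     + Ce a b * (place_mx w (size w).-1 k i * u i b 0))).
    apply: eq_bigr => i _.
    by rewrite /= lin_comb_mxE; ring.
  rewrite big_split sumrB sumrB sumrB -!mulr_sumr /=.
  rewrite (sum1 (fun i : 'I_(size w) => u i b 0)) !(sum_shift_mx _ _ (fun i => u i b 0)).
  rewrite !(sum_place_mx _ _ (fun i => u i b 0)).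
  by case: (0 < k)%N; case: (nth true w k); case: eqP => _; case: eqP => _ /=;
    rewrite ?mulr0 ?subr0 ?addr0.
have colE (X1 X2 X3 X4 : 'cV[rat]_K) :
    (X1 - X2 - X3 + X4) a 0 = X1 a 0 - X2 a 0 - X3 a 0 + X4 a 0 by rewrite !mxE.
rewrite big_split sumrB sumrB /= /transfer_val colE.
congr (_ - _ - _ + _).
- by rewrite mxE.
- by case: (0 < k)%N; [rewrite mxE|rewrite big1 ?mxE].
- by case: (_ == 0%N); [rewrite mxE|rewrite big1 ?mxE].
- by case: (_ == _); [rewrite mxE|rewrite big1 ?mxE].
Qed.

End TransferOperator.

(** * The kernel of an automaton over a block *)

Section AutomatonKernel.
Variables (r m : nat) (M0 M1 : 'M[rat]_r) (v0 : 'cV[rat]_r) (g : 'rV[rat]_r).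
Variable F : 'M[rat]_(m, r).
Hypothesis gv0 : g *m v0 = 1%:M.
Implicit Types (w : seq bool).

(** The [m] added rows hold the acceptance conditions; the [m] added columns, which
    make the matrix square, are zero and belong to the kernel. *)
Definition pad (M : 'M[rat]_r) : 'M[rat]_(r + m) := block_mx M 0 0 0.

Fixpoint state w n : 'cV[rat]_r :=
  if n is n'.+1 then (if nth true w n then M1 else M0) *m state w n' else v0.

Definition accepts w := F *m state w (size w).-1 == 0.

Local Notation K := (r + m)%N.
Local Notation tmx w := (bmx (transfer_mx (pad 1%:M) (pad M0) (pad M1) (pad (v0 *m g))
  (block_mx 0 0 F 0) w)).

Lemma mulmx_pad M (x : 'cV_r) (y : 'cV_m) : pad M *m col_mx x y = col_mx (M *m x) 0.
Proof. by rewrite mul_block_col !mul0mx !addr0. Qed.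

Lemma transfer_val_pad w (x : nat -> 'cV_r) (y : nat -> 'cV_m) n :
  transfer_val (pad 1%:M) (pad M0) (pad M1) (pad (v0 *m g)) (block_mx 0 0 F 0) w
    (fun i => col_mx (x i) (y i)) n =
  col_mx (x n - (if (0 < n)%N then (if nth true w n then M1 else M0) *m x n.-1 else 0)
           - (if n == 0%N then v0 *m (g *m x n) else 0))
         (if n == (size w).-1 then F *m x n else 0).
Proof.
rewrite /transfer_val !mulmx_pad mul1mx mul_block_col !mul0mx !addr0 mulmxA.
have -> : (if nth true w n then pad M1 else pad M0) =
    pad (if nth true w n then M1 else M0) by case: (nth true w n).
rewrite mulmx_pad.
have ifu (b : bool) (z : 'cV[rat]_r) :
    (if b then col_mx z 0 else 0) = col_mx (if b then z else 0) (0 : 'cV_m).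
  by case: b; rewrite ?col_mx0.
have ifd (b : bool) (z : 'cV[rat]_m) :
    (if b then col_mx 0 z else 0) = col_mx (0 : 'cV_r) (if b then z else 0).
  by case: b; rewrite ?col_mx0.
by rewrite !ifu ifd !opp_col_mx !add_col_mx !oppr0 !addr0 add0r.
Qed.

(** The run of the automaton, which spans the kernel over an accepted block up to
    the added columns. *)
Definition kvec w (t : bindex K w) : rat := col_mx (state w t.1) 0 t.2 0.
Definition padded (a : 'I_K) := (r <= a)%N.

Lemma paddedP a : padded a -> exists c : 'I_m, a = rshift r c.
Proof.
by rewrite /padded; case: (split_ordP a) => c -> /=; [rewrite leqNgt ltn_ord|exists c].
Qed.

Lemma tmx_padded w s t : padded t.2 -> tmx w s t = 0.
Proof.
case: t => i b /paddedP[c /= ->]; rewrite /bmx /transfer_mx /=.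
have hpad M a : pad M a (rshift r c) = 0.
  by rewrite /pad; case: (split_ordP a) => a' ->; rewrite ?block_mxEur ?block_mxEdr mxE.
have hF a : (block_mx 0 0 F 0 : 'M[rat]_K) a (rshift r c) = 0.
  by case: (split_ordP a) => a' ->; rewrite ?block_mxEur ?block_mxEdr mxE.
by rewrite !hpad hF !scale0r !subr0 addr0 mxE.
Qed.

Lemma kvec_padded w (t : bindex K w) : padded t.2 -> kvec t = 0.
Proof.
by case: t => i b /paddedP[c /= ->]; rewrite /kvec /= col_mxEd mxE.
Qed.

Lemma tmx_kvec w s : accepts w -> \sum_t tmx w s t * kvec t = 0.
Proof.
case: s => k a acc.
rewrite (transfer_valE _ _ _ _ _ (fun n => col_mx (state w n) 0)) transfer_val_pad.
rewrite [X in col_mx X _](_ : _ = 0); last first.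
  case: (nat_of_ord k) => [|n] /=; last by rewrite subr0 subrr.
  by rewrite subr0 gv0 mulmx1 subrr.
rewrite [X in col_mx _ X](_ : _ = 0) ?col_mx0 ?mxE //.
by case: eqP => // ->; apply/eqP.
Qed.

(** On a block, the equations of the kernel propagate the value at the first letter
    along the automaton; the last letter adds the acceptance condition. *)
Lemma tmx_kernel w (u : bindex K w -> rat) : is_block w ->
  (forall s, \sum_t tmx w s t * u t = 0) ->
  exists2 c : rat, (forall t, ~~ padded t.2 -> u t = c * kvec t) &
                   accepts w \/ c = 0.
Proof.
move=> bw hu.
pose U n : 'cV[rat]_K := \col_b (if insub n is Some k then u (k, b) else 0).
have UE (k : 'I_(size w)) b : U k b 0 = u (k, b) by rewrite mxE valK.
pose x n := usubmx (U n); pose y n := dsubmx (U n).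
have Uxy n : U n = col_mx (x n) (y n) by rewrite vsubmxK.
have eqs n : (n < size w)%N ->
    x n = (if (0 < n)%N then (if nth true w n then M1 else M0) *m x n.-1 else 0)
      + (if n == 0%N then v0 *m (g *m x n) else 0) /\
    (n = (size w).-1 -> F *m x n = 0).
  move=> nw; have : transfer_val (pad 1%:M) (pad M0) (pad M1) (pad (v0 *m g))
      (block_mx 0 0 F 0) w (fun i => col_mx (x i) (y i)) n = 0.
    apply/matrixP => a j; rewrite [RHS]mxE ord1.
    rewrite -[RHS](hu (Ordinal nw, a)) -[n in LHS]/(nat_of_ord (Ordinal nw)) -transfer_valE.
    by apply: eq_bigr => -[k b] _; rewrite -Uxy UE.
  rewrite transfer_val_pad -col_mx0 => /eq_col_mx[h1 h2]; split.
    by apply/eqP; rewrite -subr_eq0 opprD addrA h1.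
  by move=> nl; move: h2; rewrite nl eqxx.
have sw := block_size bw.
pose c := (g *m x 0%N) 0 0.
have xE n : (n < size w)%N -> x n = c *: state w n.
  elim: n => [|n IHn] nw; have [xn _] := eqs _ nw.
    by rewrite xn /= add0r (mx11_scalar (g *m x 0%N)) -/c mul_mx_scalar.
  by rewrite xn /= addr0 IHn 1?ltnW // -scalemxAr.
exists c.
  move=> [k b] /=; rewrite /padded -ltnNge => br.
  rewrite -UE Uxy /kvec /= (_ : b = lshift m (Ordinal br)); last exact/val_inj.
  by rewrite !col_mxEu xE // mxE.
have [_ /(_ erefl)] := eqs (size w).-1 (ltac:(by rewrite prednK)).
rewrite xE ?prednK // -scalemxAr => /eqP; rewrite scaler_eq0 => /orP[/eqP ->|h].
  by right.
by left.
Qed.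

Definition kvec_norm w : rat := \sum_t kvec (w := w) t ^+ 2.

(** The run [kvec] and the coordinate vectors of the added columns are orthogonal, so
    the projection onto the kernel is the sum of those onto the two parts. *)
Definition kproj w (s t : bindex K w) : rat :=
  (if accepts w then (kvec_norm w)^-1 else 0) * (kvec s * kvec t)
  + ((s == t) && padded s.2)%:R.

Lemma kvec_norm_neq0 w : is_block w -> kvec_norm w != 0.
Proof.
move=> bw; rewrite /kvec_norm; apply/eqP => /eqP; rewrite psumr_eq0; last first.
  by move=> t _; exact: sqr_ge0.
move=> /allP h; have sw := block_size bw.
have v00 : v0 = 0.
  apply/matrixP => a j; rewrite ord1 mxE.
  have := h (Ordinal sw, lshift m a); rewrite mem_index_enum => /(_ isT).
  by rewrite sqrf_eq0 /kvec /= col_mxEu => /eqP.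
have := congr1 (fun X : 'M[rat]_1 => X 0 0) gv0.
by rewrite v00 mulmx0 !mxE => /eqP; rewrite eq_sym oner_eq0.
Qed.

Lemma sum_padded w s (f : bindex K w -> rat) :
  \sum_t ((s == t) && padded s.2)%:R * f t = if padded s.2 then f s else 0.
Proof.
rewrite (bigD1 s) //= big1 => [|t ts]; last by rewrite eq_sym (negbTE ts) mul0r.
by rewrite eqxx addr0; case: ifP; rewrite ?mul1r ?mul0r.
Qed.

Lemma kprojE w s (f : bindex K w -> rat) : \sum_t kproj s t * f t =
  (if accepts w then (kvec_norm w)^-1 else 0) * (kvec s * \sum_t kvec t * f t)
  + if padded s.2 then f s else 0.
Proof.
rewrite -sum_padded !mulr_sumr -big_split; apply: eq_bigr => t _.
by rewrite /= /kproj mulrDl !mulrA.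
Qed.

Lemma kproj_sym w (s t : bindex K w) : kproj s t = kproj t s.
Proof.
rewrite /kproj [kvec s * _]mulrC [s == t]eq_sym; congr (_ + _%:R).
by case: eqP => [->|].
Qed.

Lemma kproj_fixed w (u : bindex K w -> rat) : is_block w ->
  (forall s, \sum_t tmx w s t * u t = 0) -> forall s, \sum_t kproj s t * u t = u s.
Proof.
move=> bw hu s; have [c uc acc] := tmx_kernel bw hu; rewrite kprojE.
have -> : \sum_t kvec t * u t = c * kvec_norm w.
  rewrite mulr_sumr; apply: eq_bigr => t _.
  have [pt|npt] := boolP (padded t.2); first by rewrite kvec_padded // mul0r expr0n mulr0.
  by rewrite uc // expr2 mulrCA.
have [ps|nps] := boolP (padded s.2).
  by rewrite kvec_padded // mul0r mulr0 add0r.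
rewrite addr0 uc //; have nz := kvec_norm_neq0 bw.
case: acc => [->|->]; last by rewrite !(mul0r, mulr0).
by field.
Qed.

Lemma tmx_kproj w s t : \sum_r0 tmx w s r0 * kproj r0 t = 0.
Proof.
set c := if accepts w then (kvec_norm w)^-1 else 0.
transitivity (c * kvec t * \sum_r0 tmx w s r0 * kvec r0).
  rewrite mulr_sumr; apply: eq_bigr => r0 _; rewrite /kproj -/c mulrDr.
  rewrite [X in _ + X](_ : _ = 0) ?addr0; first by ring.
  have [pt|_] := boolP (padded r0.2); first by rewrite tmx_padded ?mul0r.
  by rewrite andbF mulr0.
rewrite /c; case: ifP => acc; last by rewrite !mul0r.
by rewrite tmx_kvec // mulr0.
Qed.

Lemma kproj_idem w (s t : bindex K w) : is_block w ->
  \sum_r0 kproj s r0 * kproj r0 t = kproj s t.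
Proof.
move=> bw.
under eq_bigr do rewrite (kproj_sym _ t).
under eq_bigr do rewrite [kproj t _]kproj_sym.
apply: (kproj_fixed bw (u := fun s => kproj s t)) => s'.
exact: tmx_kproj.
Qed.

Lemma kproj_trace w : is_block w ->
  \sum_t kproj (w := w) t t = (accepts w)%:R + (m * size w)%:R :> rat.
Proof.
move=> bw; rewrite /kproj big_split /= -mulr_sumr; congr (_ + _).
  under eq_bigr do rewrite -expr2.
  by case: ifP => _; rewrite ?mul0r // mulVf ?kvec_norm_neq0.
under eq_bigr do rewrite eqxx /=.
rewrite -(pair_bigA _ (fun (i : 'I_(size w)) (a : 'I_K) => (padded a)%:R : rat)) /=.
rewrite sumr_const card_ord natrM -[LHS]mulr_natr; congr (_ * _).
rewrite big_split_ord /= big1 => [|i _]; last by rewrite /padded /= leqNgt ltn_ord.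
rewrite add0r (eq_bigr (fun=> 1)) => [|i _]; last by rewrite /padded /= leq_addr.
by rewrite sumr_const card_ord.
Qed.

End AutomatonKernel.

(** * The l2-Betti number of an automaton *)

Section BlockSums.
Variables (A : algType rat) (L : shift_frame A) (k : nat).
Implicit Types (X Y : forall w, bindex k w -> bindex k w -> rat) (s : seq (seq bool)).

Definition block_sum X s : 'M[A]_k := \sum_(w <- s) block_emb L (X w).

Lemma block_sum_mull X Y s s' : all is_block s' -> uniq s' -> {subset s <= s'} ->
  block_sum X s *m block_sum Y s' = block_sum (fun w => bmul (X w) (Y w)) s.
Proof.
move=> /allP bs' us' ss'; rewrite /block_sum mulmx_suml; apply: eq_big_seq => w /ss' ws.
rewrite (bigD1_seq w) //= mulmxDr block_embM; last exact: bs'.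
rewrite mulmx_sumr big1_seq ?addr0 // => w' /andP[ww' ws'].
by rewrite block_embM_neq ?bs' // eq_sym.
Qed.

Lemma block_sum_mulr X Y s s' : all is_block s' -> uniq s' -> {subset s <= s'} ->
  block_sum X s' *m block_sum Y s = block_sum (fun w => bmul (X w) (Y w)) s.
Proof.
move=> /allP bs' us' ss'; rewrite /block_sum mulmx_sumr; apply: eq_big_seq => w /ss' ws.
rewrite (bigD1_seq w) //= mulmxDl block_embM; last exact: bs'.
rewrite mulmx_suml big1_seq ?addr0 // => w' /andP[ww' ws'].
by rewrite block_embM_neq ?bs'.
Qed.

Lemma eq_block_sum X Y s : (forall w, w \in s -> forall t t', X w t t' = Y w t t') ->
  block_sum X s = block_sum Y s.
Proof. by move=> XY; apply: eq_big_seq => w /XY; exact: eq_block_emb. Qed.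

Lemma star_block_sum X s a b : (forall w t t', X w t t' = X w t' t) ->
  block_sum X s a b = fstar L (block_sum X s b a).
Proof.
move=> Xs; rewrite !summxE fstar_sum; apply: eq_bigr => w _.
by rewrite star_block_emb; congr (fun_of_matrix _ a b); apply: eq_block_emb.
Qed.

Lemma tr_block_sum X s a : ftr L (block_sum X s a a) =
  \sum_(w <- s) 2^-1 ^+ (size w).+2 * \sum_i X w (i, a) (i, a).
Proof.
by rewrite summxE ftr_sum; apply: eq_bigr => w _; exact: tr_block_emb.
Qed.

End BlockSums.

Lemma geometric_squeeze (R : realType) (f : nat -> rat) (a c : rat) (N : nat -> nat) :
  0 <= c < 1 -> (forall n, 1 - a * c ^+ n <= f n <= 1) -> (forall n, (n <= N n)%N) ->
  ((fun n => ratr (f (N n)) : R) @ \oo --> (1 : R))%classic.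
Proof.
move=> /andP[c0 c1] hf nN; have Nlim : (N @ \oo --> \oo)%classic.
  move=> S [n _ nS]; exists n => // k /= nk; apply: nS => /=.
  exact: leq_trans nk (nN k).
have geo : ((fun n => 1 - ratr a * ratr c ^+ n : R) @ \oo --> (1 : R))%classic.
  rewrite -[X in (_ --> X)%classic](subr0 1) -(mulr0 (ratr a)).
  apply: cvgB; first exact: cvg_cst.
  apply: cvgMr; apply: cvg_expr.
  by rewrite ger0_norm ?ler0q // -(rmorph1 (ratr : rat -> R)) ltr_rat.
have := cvg_comp _ _ Nlim geo; move=> {}geo.
apply: (squeeze_cvgr _ geo (_ : (fun=> 1 : R) @ \oo --> (1 : R))%classic);
  last exact: cvg_cst.
exists 0%N => // n _ /=; have /andP[lo hi] := hf (N n).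
rewrite -(rmorph1 (ratr : rat -> R)) -rmorphXn -rmorphM -rmorphB !ler_rat.
by rewrite lo hi.
Qed.

Section TransferBetti.
Variables (R : realType) (r m : nat) (M0 M1 : 'M[rat]_r) (v0 : 'cV[rat]_r) (g : 'rV[rat]_r).
Variable F : 'M[rat]_(m, r).
Hypothesis gv0 : g *m v0 = 1%:M.
Local Open Scope classical_set_scope.
Local Notation K := (r + m)%N.
Local Notation L := lamp_frame.

(** The functional [g] takes the value 1 at [v0], so the first vector [v] is subject
    to [v = (g v) v0], that is, to lie on the line of [v0]. *)
Definition automaton_op : 'M[grpalg lamplighter]_K :=
  transfer_op L (pad m 1%:M) (pad m M0) (pad m M1) (pad m (v0 *m g)) (block_mx 0 0 F 0).

Local Notation tmx w := (bmx (transfer_mx (pad m 1%:M) (pad m M0) (pad m M1)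
  (pad m (v0 *m g)) (block_mx 0 0 F 0) w)).

Lemma padded_mass N :
  \sum_(w <- blocks N) 2^-1 ^+ (size w).+2 * (m * size w)%:R = m%:R * block_mass N.
Proof.
rewrite mulr_sumr; apply: eq_bigr => w _.
by rewrite natrM mulrCA; congr (_ * _); rewrite mulrC.
Qed.

Definition accepted_mass N : rat :=
  \sum_(w <- blocks N) (accepts M0 M1 v0 F w)%:R * 2^-1 ^+ (size w).+2.

Lemma cvg_block_mass (N : nat -> nat) : (forall n, (n <= N n)%N) ->
  (fun n => ratr (block_mass (N n)) : R) @ \oo --> (1 : R).
Proof.
move=> nN; apply: (geometric_squeeze (c := 119 / 128) _ block_mass_tail nN).
by apply/andP; split; lra.
Qed.

(** The kernel over a block has dimension [m] times the number of letters, plus 1 if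
    the block is accepted. *)
Lemma automaton_l2betti (N : nat -> nat) :
  (forall n, (n <= N n)%N) -> {homo N : i j / (i <= j)%N} ->
  (fun n => ratr (accepted_mass (N n) + m%:R * block_mass (N n)) : R) @ \oo -->
    l2betti R automaton_op.
Proof.
move=> nN Nmono.
have blk n : all is_block (blocks (N n)).
  by apply/allP => w; rewrite mem_blocks => /andP[].
have sub n n' : (n <= n')%N -> {subset blocks (N n) <= blocks (N n')}.
  by move=> nn' w; rewrite !mem_blocks => /andP[-> /leq_trans -> //]; exact: Nmono.
have act w a b : is_block w -> acts L (automaton_op a b)
    (transfer_mx (pad m 1%:M) (pad m M0) (pad m M1) (pad m (v0 *m g))
      (block_mx 0 0 F 0) w a b).
  exact: acts_transfer.
have [B BE] : exists B : forall w, bindex K w -> bindex K w -> rat, forall w, is_block w ->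
    forall s t, (s == t)%:R - kproj M0 M1 v0 F s t = bmul (B w) (tmx w) s t.
  suff h w : {B : bindex K w -> bindex K w -> rat | is_block w ->
      forall s t, (s == t)%:R - kproj M0 M1 v0 F s t = bmul B (tmx w) s t}.
    by exists (fun w => sval (h w)) => w; exact: (svalP (h w)).
  apply: cid; have [bw|nbw] := boolP (is_block w); last by exists (fun _ _ => 0).
  have [B hB] := @compl_factor _ (tmx w) (@kproj r m M0 M1 v0 F w)
    (fun u hu => kproj_fixed gv0 bw hu).
  by exists B => _; exact: hB.
pose q w := @kproj r m M0 M1 v0 F w.
pose one w (s t : bindex K w) : rat := (s == t)%:R.
pose P n : 'M[grpalg lamplighter]_K := block_sum L q (blocks (N n)).
pose Z n : 'M[grpalg lamplighter]_K := block_sum L one (blocks (N n)).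
have one_sym w t t' : @one w t t' = one w t' t by rewrite /one eq_sym.
have q_sym w t t' : q w t t' = q w t' t by exact: kproj_sym.
have one_mul w s t : bmul (@one w) (@one w) s t = one w s t.
  rewrite /bmul (bigD1 s) //= big1 => [|u us]; last first.
    by rewrite /one eq_sym (negbTE us) mul0r.
  by rewrite addr0 /one eqxx mul1r.
have q_mul w : is_block w -> forall s t, bmul (q w) (q w) s t = q w s t.
  by move=> bw s t; exact: (kproj_idem M0 M1 F gv0 s t bw).
have := @l2betti_exhaustion R lamplighter K automaton_op P Z
  (fun n => block_sum L B (blocks (N n))).
rewrite (_ : (fun n => ratr (\sum_i gcoef 1%g (P n i i))) =
    fun n => ratr (accepted_mass (N n) + m%:R * block_mass (N n)) : R); last first.
  apply/funext => n; congr ratr; rewrite -padded_mass -big_split /=.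
  transitivity (\sum_(i < K) \sum_(w <- blocks (N n))
      2^-1 ^+ (size w).+2 * \sum_j q w (j, i) (j, i)).
    by apply: eq_bigr => i _; exact: (tr_block_sum L).
  rewrite exchange_big /=; apply: eq_big_seq => w wN.
  rewrite -mulr_sumr exchange_big pair_bigA /= [_%:R * _]mulrC -mulrDr; congr (_ * _).
  rewrite -(kproj_trace M0 M1 F gv0); last exact: (allP (blk n)).
  by apply: eq_bigr => -[].
apply.
- move=> n; rewrite mulmx_sumr big1_seq // => w /andP[_ /(allP (blk n)) bw].
  rewrite (acts_block_emb _ (fun a b => act w a b bw)).
  apply/matrixP => a b; rewrite !mxE big1 // => i _; rewrite big1 // => j _.
  by rewrite [bmul _ _ _ _](tmx_kproj M0 M1 F gv0) scale0r.
- move=> n; apply/eqP; rewrite eq_sym subr_eq addrC -subr_eq; apply/eqP.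
  rewrite /P /Z /block_sum mulmx_suml -sumrB; apply: eq_big_seq => w /(allP (blk n)) bw.
  rewrite block_embB (block_emb_acts _ (fun a b => act w a b bw)).
  by apply: eq_block_emb => s t; exact: BE.
- by move=> n a b; exact: (star_block_sum L).
- by move=> n a b; exact: (star_block_sum L).
- move=> n n' nn'; rewrite (block_sum_mull L q q (blk n') (uniq_blocks _) (sub _ _ nn')).
  rewrite (block_sum_mulr L q q (blk n') (uniq_blocks _) (sub _ _ nn')).
  by split; apply: eq_block_sum => w /(allP (blk n)) bw; exact: q_mul.
- move=> n; rewrite (block_sum_mull L one one (blk n) (uniq_blocks _) (sub _ _ (leqnn n))).
  by apply: eq_block_sum => w _; exact: one_mul.
move=> a; rewrite (_ : (fun n => _) = fun n => ratr (block_mass (N n))).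
  exact: cvg_block_mass.
apply/funext => n; congr ratr; transitivity (\sum_(w <- blocks (N n))
    2^-1 ^+ (size w).+2 * \sum_j one w (j, a) (j, a)); first exact: (tr_block_sum L).
apply: eq_bigr => w _; rewrite mulrC; congr (_ * _).
by under eq_bigr do rewrite /one eqxx; rewrite sumr_const card_ord.
Qed.

End TransferBetti.

(** * Linear recurrences *)

Section LinearRecurrences.
Implicit Types f : nat -> rat.

Definition linear_recurrent f := exists s (C : 'M[rat]_s) (e : 'rV[rat]_s) (v : 'cV[rat]_s),
  forall k, (e *m iter k (mulmx C) v) 0 0 = f k.

Lemma eq_linear_recurrent f f' : f =1 f' -> linear_recurrent f -> linear_recurrent f'.
Proof. by move=> ff' [s [C [e [v h]]]]; exists s, C, e, v => k; rewrite h ff'. Qed.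

Lemma linear_recurrent_const c : linear_recurrent (fun=> c).
Proof.
exists 1, 1%:M, 1%:M, c%:M => k.
have -> : iter k (mulmx 1%:M) c%:M = c%:M :> 'M[rat]_1.
  by elim: k => //= k ->; rewrite mul1mx.
by rewrite mul1mx mxE eqxx.
Qed.

Lemma linear_recurrentD f f' : linear_recurrent f -> linear_recurrent f' ->
  linear_recurrent (fun k => f k + f' k).
Proof.
move=> [s [C [e [v h]]]] [s' [C' [e' [v' h']]]].
exists (s + s')%N, (block_mx C 0 0 C'), (row_mx e e'), (col_mx v v') => k.
have -> : iter k (mulmx (block_mx C 0 0 C')) (col_mx v v') =
    col_mx (iter k (mulmx C) v) (iter k (mulmx C') v').
  by elim: k => //= k ->; rewrite mul_block_col !mul0mx addr0 add0r.
by rewrite mul_row_col mxE h h'.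
Qed.

(** A Jordan block multiplies by the index. *)
Lemma linear_recurrent_mulk f : linear_recurrent f ->
  linear_recurrent (fun k => f k * k%:R).
Proof.
move=> [s [C [e [v h]]]].
exists (s + s)%N, (block_mx C C 0 C), (row_mx e 0), (col_mx 0 v) => k.
have -> : iter k (mulmx (block_mx C C 0 C)) (col_mx 0 v) =
    col_mx (k%:R *: iter k (mulmx C) v) (iter k (mulmx C) v).
  elim: k => [|k /= ->]; first by rewrite scale0r.
  rewrite mul_block_col mul0mx add0r -scalemxAr -natr1 scalerDl scale1r.
  by [].
by rewrite mul_row_col mul0mx addr0 -scalemxAr mxE h mulrC.
Qed.

Lemma linear_recurrent_geom (d : rat) f : linear_recurrent f ->
  linear_recurrent (fun k => f k * d ^+ k).
Proof.
move=> [s [C [e [v h]]]]; exists s, (d *: C), e, v => k.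
have -> : iter k (mulmx (d *: C)) v = d ^+ k *: iter k (mulmx C) v.
  elim: k => [|k /= ->]; first by rewrite scale1r.
  by rewrite -scalemxAl -scalemxAr scalerA -exprS.
by rewrite -scalemxAr mxE h mulrC.
Qed.

Lemma linear_recurrent_poly (p : {poly nat}) : linear_recurrent (fun k => (p.[k])%:R).
Proof.
elim/poly_ind: p => [|p c IHp].
  apply: (eq_linear_recurrent _ (linear_recurrent_const 0)) => k.
  by rewrite horner0.
apply: (eq_linear_recurrent _ (linear_recurrentD (linear_recurrent_mulk IHp)
  (linear_recurrent_const c%:R))) => k.
by rewrite hornerMXaddC natrD natrM.
Qed.

Lemma linear_recurrent_sum I (r : seq I) (F : I -> nat -> rat) :
  (forall i, linear_recurrent (F i)) -> linear_recurrent (fun k => \sum_(i <- r) F i k).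
Proof.
move=> hF; elim: r => [|i r IHr].
  by apply: (eq_linear_recurrent _ (linear_recurrent_const 0)) => k; rewrite big_nil.
by apply: (eq_linear_recurrent _ (linear_recurrentD (hF i) IHr)) => k; rewrite big_cons.
Qed.

Lemma linear_recurrent_exponent n (p : 'I_n.+1 -> {poly nat}) (d : 'I_n -> nat) :
  linear_recurrent (fun k => (exponent p d k)%:R).
Proof.
apply: (eq_linear_recurrent _ (linear_recurrentD (linear_recurrent_poly (p ord0))
  (linear_recurrent_sum (index_enum _) (fun i => linear_recurrent_geom (d i)%:R
     (linear_recurrent_poly (p (lift ord0 i))))))) => k.
rewrite /exponent natrD natr_sum; congr (_ + _); apply: eq_bigr => i _.
by rewrite natrM natrX.
Qed.

End LinearRecurrences.

Section Exponent.
Variables (n : nat) (p : 'I_n.+1 -> {poly nat}) (d : 'I_n -> nat).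
Hypothesis p0_lin : (1 <= ((p ord0)`_1)%R)%N.
Hypothesis d_ge2 : forall i : 'I_n, (2 <= d i)%N.

Lemma horner_nat_le (q : {poly nat}) (j k : nat) : (j <= k)%N -> (q.[j] <= q.[k])%N.
Proof.
move=> jk; elim/poly_ind: q => [|q c IHq]; first by rewrite !horner0.
by rewrite !hornerMXaddC !natrDE !natrME leq_add2r leq_mul.
Qed.

Lemma coef0_le_horner (q : {poly nat}) (k : nat) : ((q`_0)%R <= q.[k])%N.
Proof.
elim/poly_ind: q => [|q c _]; first by rewrite horner0 coef0.
by rewrite hornerMXaddC coefD coefMX coefC eqxx /= natrDE natrME leq_addl.
Qed.

(** Write the polynomial as [q X + c]: the values of [q] are at least its constant
    coefficient, the linear coefficient of the polynomial. *)
Lemma horner_nat_lt (q : {poly nat}) (j k : nat) :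
  (1 <= (q`_1)%R)%N -> (j < k)%N -> (q.[j] < q.[k])%N.
Proof.
elim/poly_ind: q => [|q c _]; first by rewrite coef0.
rewrite coefD coefMX coefC /= addr0 !hornerMXaddC !natrDE !natrME ltn_add2r => q0 jk.
apply: (@leq_ltn_trans (q.[k] * j)%N).
  by rewrite leq_mul2r horner_nat_le ?orbT // ltnW.
by rewrite ltn_mul2l jk andbT (leq_trans q0) // coef0_le_horner.
Qed.

Lemma exponent_lt : {homo exponent p d : j k / (j < k)%N}.
Proof.
move=> j k jk; rewrite /exponent -addSn; apply: leq_add; first exact: horner_nat_lt.
apply: leq_sum => i _; apply: leq_mul; first exact/horner_nat_le/ltnW.
by apply: leq_pexp2l; [exact: ltnW (d_ge2 i)|exact: ltnW].
Qed.

End Exponent.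

(** * An automaton that recognizes one block for each index *)

Section RecognizingAutomaton.
Variables (E : nat -> nat) (s : nat) (C : 'M[rat]_s) (e : 'rV[rat]_s) (v : 'cV[rat]_s).
Hypothesis Erec : forall k, (e *m iter k (mulmx C) v) 0 0 = (E k)%:R.
Implicit Types (w t : seq bool).

(** Besides the linear recurrence [y], a state carries a constant [c], the number
    [a] of letters 1 read after the first one, and an accumulator [z]. The letter 0
    advances [y]; the letter 1 adds to [z] the value [e y] computed so far and
    resets [y]. Each letter subtracts 1 from [z]. *)
Definition scalars (c a z : rat) : 'cV[rat]_3 :=
  c *: delta_mx 0 0 + a *: delta_mx 1 0 + z *: delta_mx 2 0.

Definition read0 : 'M[rat]_(s + 3) :=
  block_mx C 0 0 (1%:M - delta_mx 2 0).
Definition read1 : 'M[rat]_(s + 3) :=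
  block_mx 0 0 (delta_mx 2 0 *m e) (1%:M + delta_mx 1 0 - delta_mx 2 0).
(** The initial value 3 makes [z] vanish at the end of [1 0^k 1 0^m 1], after
    [k + m + 2] further letters, precisely when [k + m = E k + 1]. *)
Definition start : 'cV[rat]_(s + 3) := col_mx v (scalars 1 0 3).
Definition unit_coord : 'rV[rat]_(s + 3) := row_mx 0 (delta_mx 0 0).
(** The final conditions [a = 2 c] and [z = 0]. *)
Definition checks : 'M[rat]_(2, s + 3) :=
  row_mx 0 (delta_mx 0 1 - 2 *: delta_mx 0 0 + delta_mx 1 2).

Lemma unit_coord_start : unit_coord *m start = 1%:M.
Proof.
rewrite mul_row_col mul0mx add0r /scalars !mulmxDr -!scalemxAr !mul_delta_mx_cond.
by apply/matrixP => i j; rewrite !ord1 !mxE /=; ring.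
Qed.

Lemma delta_scalars n (i : 'I_n) (j : 'I_3) c a z :
  delta_mx i j *m scalars c a z = (scalars c a z) j 0 *: delta_mx i 0.
Proof.
apply/matrixP => i' k; rewrite !ord1 mxE (bigD1 j) //= big1 => [|l lj].
  by rewrite !mxE addr0 eqxx andbT mulrC eqxx andbT.
by rewrite [delta_mx _ _ _ _]mxE (negbTE lj) andbF mul0r.
Qed.

Lemma scalars0 c a z : scalars c a z 0 0 = c.
Proof. by rewrite !mxE /=; ring. Qed.
Lemma scalars1 c a z : scalars c a z 1 0 = a.
Proof. by rewrite !mxE /=; ring. Qed.
Lemma scalars2 c a z : scalars c a z 2 0 = z.
Proof. by rewrite !mxE /=; ring. Qed.

Lemma read0E y a z :
  read0 *m col_mx y (scalars 1 a z) = col_mx (C *m y) (scalars 1 a (z - 1)).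
Proof.
rewrite mul_block_col !mul0mx addr0 add0r; congr col_mx.
rewrite mulmxBl mul1mx delta_scalars scalars0 scale1r /scalars scalerBl !scale1r.
by rewrite addrA.
Qed.

Lemma read1E y a z : read1 *m col_mx y (scalars 1 a z) =
  col_mx 0 (scalars 1 (a + 1) (z - 1 + (e *m y) 0 0)).
Proof.
rewrite mul_block_col !mul0mx addr0; congr col_mx.
rewrite mulmxBl mulmxDl mul1mx !delta_scalars !scalars0 !scale1r -mulmxA.
rewrite {1}(mx11_scalar (e *m y)) mul_mx_scalar; move: ((e *m y) 0 0) => c.
rewrite /scalars.
move: (delta_mx 0 0) (delta_mx 1 0) (delta_mx 2 0) => d0 d1 d2.
by apply/matrixP => i j; rewrite !mxE; ring.
Qed.

Lemma checksE y a z : (checks *m col_mx y (scalars 1 a z) == 0) = (a == 2) && (z == 0).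
Proof.
rewrite mul_row_col mul0mx add0r mulmxDl mulmxBl -scalemxAl !delta_scalars.
rewrite scalars0 scalars1 scalars2; apply/eqP/andP => [/matrixP h|[/eqP -> /eqP ->]].
  split; [have := h 0 0|have := h 1 0]; rewrite !mxE /= => /eqP.
    by rewrite !(mulr1, mulr0, addr0) subr_eq0.
  by rewrite !(mulr1, mulr0, add0r, subr0).
by rewrite scale1r subrr scale0r addr0.
Qed.

Fixpoint run (y : 'cV[rat]_s) (a z : rat) t : 'cV[rat]_s * (rat * rat) :=
  match t with
  | [::] => (y, (a, z))
  | b :: t' => if b then run 0 (a + 1) (z - 1 + (e *m y) 0 0) t'
               else run (C *m y) a (z - 1) t'
  end.

Lemma state_run t : state read0 read1 start (true :: t) (size t) =
  let: (y, (a, z)) := run v 0 3 t in col_mx y (scalars 1 a z).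
Proof.
pose stepb (V : 'cV[rat]_(s + 3)) (b : bool) := (if b then read1 else read0) *m V.
have st n : (n <= size t)%N ->
    state read0 read1 start (true :: t) n = foldl stepb start (take n t).
  elim: n => [|n IHn] nt; first by rewrite take0.
  by rewrite (take_nth true nt) foldl_rcons /= IHn 1?ltnW.
rewrite st // take_size /start; move: v (0 : rat) (3 : rat).
elim: {st} t => [|[] t IHt] y a z //=.
- by rewrite {2}/stepb read1E IHt.
- by rewrite {2}/stepb read0E IHt.
Qed.

Lemma run_count y a z t : (run y a z t).2.1 = a + (count id t)%:R.
Proof.
elim: t y a z => [|[] t IHt] y a z /=; rewrite ?addr0 // IHt.
by rewrite natrD addrA.
Qed.

Lemma run_cat y a z t t' : run y a z (t ++ t') =
  let: (y', (a', z')) := run y a z t in run y' a' z' t'.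
Proof. by elim: t y a z => [|[] t IHt] y a z //=. Qed.

Lemma run_nseq0 y a z n :
  run y a z (nseq n false) = (iter n (mulmx C) y, (a, z - n%:R)).
Proof.
elim: n y a z => [|n IHn] y a z /=; first by rewrite subr0.
by rewrite IHn -iterSr -natr1 opprD addrA addrAC.
Qed.

Definition gap_tail j m : seq bool := nseq j false ++ true :: nseq m false ++ [:: true].

Lemma run_gap_tail j m :
  (run v 0 3 (gap_tail j m)).2.2 = (E j)%:R + 1 - j%:R - m%:R.
Proof.
rewrite run_cat run_nseq0 /= run_cat run_nseq0 /= Erec.
have -> : iter m (mulmx C) 0 = 0 :> 'cV[rat]_s.
  by elim: m => //= m ->; rewrite mulmx0.
by rewrite mulmx0 mxE; ring.
Qed.

Lemma count_gap_tail j m : count id (gap_tail j m) = 2%N.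
Proof. by rewrite /gap_tail count_cat /= count_cat !count_nseq. Qed.

Lemma size_gap_tail j m : size (gap_tail j m) = (j + m).+2.
Proof. by rewrite /gap_tail size_cat /= size_cat !size_nseq addn1 !addnS. Qed.

Lemma path_nseq0 b n : path no11 b (nseq n false).
Proof. by elim: n b => // n IHn b; rewrite /= IHn /no11 andbF. Qed.

Lemma gap_tail_is_tail j m : is_tail (gap_tail j.+1 m.+1).
Proof.
have last0 n : last false (nseq n false) = false by elim: n.
rewrite /is_tail /gap_tail cat_path path_nseq0 last_cat /= cat_path path_nseq0 last_cat /=.
by rewrite !last0 /= ?last0.
Qed.

Lemma split_first1 t : has id t -> exists n t', t = nseq n false ++ true :: t'.
Proof.
elim: t => // -[] t IHt; first by exists 0%N, t.
by move=> /IHt[n [t' ->]]; exists n.+1, t'.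
Qed.

Lemma tail_gap t : is_tail t -> count id t = 2%N ->
  exists j m, t = gap_tail j.+1 m.+1.
Proof.
move=> /andP[pt lt] c2; have [|j [t1 tE]] := @split_first1 t.
  by rewrite has_count c2.
have c1 : count id t1 = 1%N.
  by move: c2; rewrite tE count_cat count_nseq mul0n add0n /= => -[].
have [|m [t2 t1E]] := @split_first1 t1; first by rewrite has_count c1.
have c0 : count id t2 = 0%N.
  by move: c1; rewrite t1E count_cat count_nseq mul0n add0n /= => -[].
have t20 : t2 = [::].
  move: lt; rewrite tE t1E !(last_cat, last_cons).
  case/lastP: t2 c0 {t1E} => // t2 b; rewrite last_rcons -cats1 count_cat => c0 bt.
  by move: c0; rewrite bt /= addn1.
exists j.-1, m.-1; rewrite !prednK.
- by rewrite tE t1E t20.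
- move: pt; rewrite tE cat_path => /andP[_]; rewrite /= => /andP[_].
  by rewrite t1E; case: m {t1E}.
- by move: pt; rewrite tE; case: j {tE}.
Qed.

Definition code k : seq bool := true :: gap_tail k ((E k).+1 - k).

Hypothesis E_lt : {homo E : j k / (j < k)%N}.

Lemma index_le k : (k <= E k)%N.
Proof. by elim: k => // k IHk; apply: leq_ltn_trans IHk _; exact: E_lt. Qed.

Lemma size_code k : size (code k) = (E k + 4)%N.
Proof. by rewrite /= size_gap_tail; have := index_le k; lia. Qed.

Lemma code_inj : injective code.
Proof.
move=> j k jk; have : E j = E k by have := congr1 size jk; rewrite !size_code; lia.
by case: (ltngtP j k) => // /E_lt; lia.
Qed.

Lemma code_is_block k : (0 < k)%N -> is_block (code k).
Proof.
case: k => // k _; have := index_le k.+1 => kE /=.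
by rewrite (_ : ((E k.+1).+1 - k.+1 = (E k.+1 - k.+1).+1)%N) ?gap_tail_is_tail //; lia.
Qed.

(** Exactly two further letters 1 leave the shape [1 0^k 1 0^m 1], and then [z]
    determines [m]. *)
Lemma accepts_block w : is_block w ->
  accepts read0 read1 start checks w <-> exists2 k, (0 < k)%N & w = code k.
Proof.
case: w => // -[] // t /= ht; rewrite /accepts [X in state _ _ _ _ X]/= state_run.
case rt : (run v 0 3 t) => [y [a z]]; rewrite checksE.
have aE : a = (count id t)%:R by have := run_count v 0 3 t; rewrite rt add0r.
split=> [/andP[/eqP a2 /eqP z0]|[k k0 [tE]]].
  have c2 : count id t = 2%N by apply/eqP; rewrite -(eqr_nat rat) -aE a2.
  have [j [m tE]] := tail_gap ht c2; exists j.+1 => //.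
  have : z = (run v 0 3 (gap_tail j.+1 m.+1)).2.2 by rewrite -tE rt.
  rewrite run_gap_tail z0 tE /code => zE; congr (_ :: gap_tail _ _).
  have /eqP : (m.+1 + j.+1)%:R = ((E j.+1).+1)%:R :> rat.
    by rewrite natrD -[in RHS]natr1; lra.
  by rewrite eqr_nat => /eqP; lia.
rewrite aE tE count_gap_tail eqxx /=.
have : z = (run v 0 3 (gap_tail k ((E k).+1 - k))).2.2 by rewrite -tE rt.
rewrite run_gap_tail natrB; last by have := index_le k; lia.
by rewrite -natr1 => ->; apply/eqP; ring.
Qed.

Lemma accepted_mass_code K : accepted_mass read0 read1 start checks (E K + 4) =
  \sum_(1 <= k < K.+1) 2^-1 ^+ (E k + 6).
Proof.
rewrite /accepted_mass.
transitivity (\sum_(w <- blocks (E K + 4) | accepts read0 read1 start checks w)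
    2^-1 ^+ (size w).+2 : rat).
  rewrite [RHS]big_mkcond; apply: eq_bigr => w _.
  by case: ifP; rewrite ?mul1r ?mul0r.
rewrite -big_filter (perm_big [seq code k | k <- index_iota 1 K.+1]).
  by rewrite big_map; apply: eq_bigr => k _; rewrite size_code !addnS !addn0.
apply: uniq_perm.
- exact/filter_uniq/uniq_blocks.
- by rewrite map_inj_uniq ?iota_uniq //; exact: code_inj.
move=> w; rewrite mem_filter mem_blocks; apply/idP/mapP => [/and3P[acc bw sw]|[k]].
  have [k k0 wE] := (accepts_block bw).1 acc; exists k => //.
  rewrite mem_index_iota k0 ltnS leqNgt; apply/negP => /E_lt.
  by move: sw; rewrite wE size_code; lia.
rewrite mem_index_iota ltnS => /andP[k0 kK] ->.
rewrite size_code code_is_block // leq_add2r.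
apply/and3P; split=> //; first by apply/(accepts_block (code_is_block k0)); exists k.
by move: kK; rewrite leq_eqVlt => /orP[/eqP ->|/E_lt/ltnW].
Qed.

End RecognizingAutomaton.

(** * The l2-Betti number and the group it generates *)

Section AlgebraMembership.
Local Open Scope classical_set_scope.

Lemma automaton_op_in_algebra r m (M0 M1 : 'M[rat]_r) v0 g (F : 'M[rat]_(m, r)) i j :
  algebra_half (automaton_op M0 M1 v0 g F i j).
Proof.
move=> S [[S1 SZD SM Sstar] genS].
have SZ q a : S a -> S (q *: a).
  move=> Sa; have S0 : S 0 by rewrite -(subrr 1) addrC -scaleN1r; exact: SZD.
  by have := SZD q a 0 Sa S0; rewrite addr0.
have SD a b : S a -> S b -> S (a + b) by move=> Sa Sb; rewrite -(scale1r a); exact: SZD.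
have SB a b : S a -> S b -> S (a - b).
  by move=> Sa Sb; apply: SD => //; rewrite -scaleN1r; exact: SZ.
have S00 : S (step lamp_frame false false).
  by apply: genS; left; left; rewrite /= /step /= !lamp_eE.
have S01 : S (step lamp_frame false true).
  by apply: genS; left; right; rewrite /= /step /= !lamp_e_compl !lamp_eE.
have S10 : S (step lamp_frame true false).
  by apply: genS; right; rewrite /= /step /= !lamp_e_compl !lamp_eE.
have Sstep0 : S (step0 lamp_frame) by rewrite /step0; apply: SD S00 S10.
have Sstep1 : S (step1 lamp_frame) by exact: S01.
have Sstep : S (step01 lamp_frame) by rewrite /step01; apply: SD Sstep0 Sstep1.
have Sstep' : S (fstar lamp_frame (step01 lamp_frame)) by exact: Sstar Sstep.
have Sfirst : S (first_proj lamp_frame).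
  by rewrite /first_proj; apply: SB S1 (SM _ _ Sstep Sstep').
have Slast : S (last_proj lamp_frame).
  by rewrite /last_proj; apply: SB S1 (SM _ _ Sstep' Sstep).
rewrite /automaton_op mxE; apply: SD; last exact: SZ Slast.
apply: (SB); last exact: SZ Sfirst.
apply: (SB); last exact: SZ Sstep1.
by apply: (SB); [exact: SZ S1|exact: SZ Sstep0].
Qed.

End AlgebraMembership.

Section BettiGroup.
Variables (R : realType) (G : groupType).

Lemma l2betti0 k : l2betti R (0 : 'M[grpalg G]_k) = k%:R.
Proof.
have := @l2betti_exhaustion R G k 0 (fun=> 1%:M) (fun=> 1%:M) (fun=> 0).
rewrite (_ : (fun n => _) = fun=> k%:R); last first.
  apply/funext => _; under eq_bigr do rewrite mxE eqxx gcoef1_one.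
  by rewrite sumr_const card_ord rmorph_nat.
move=> h; apply/esym.
apply: (cvg_unique (@norm_hausdorff _ _)) (cvg_cst _) (h _ _ _ _ _ _ _).
- by move=> _; rewrite mul0mx.
- by move=> _; rewrite mul0mx subr0.
- by move=> _; exact: selfadj_mx1.
- by move=> _; exact: selfadj_mx1.
- by move=> *; rewrite !mulmx1.
- by move=> _; rewrite mulmx1.
move=> i; rewrite (_ : (fun n => _) = fun=> 1); first exact: cvg_cst.
by apply/funext => _; rewrite mxE eqxx gcoef1_one rmorph1.
Qed.

Lemma l2betti_group_sub (x y : R) : l2betti_group R G x -> l2betti_group R G y ->
  l2betti_group R G (x - y).
Proof. by move=> hx hy H [hH BH]; apply: hH.2; [exact: hx|exact: hy]. Qed.

Lemma l2betti_group_mulrn (x : R) n : l2betti_group R G x -> l2betti_group R G (x *+ n).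
Proof.
move=> hx; have h0 : l2betti_group R G 0 by rewrite -(subrr x); exact: l2betti_group_sub.
elim: n => [|n IHn]; first by rewrite mulr0n.
rewrite mulrS addrC -[x in _ + x]opprK -[- x]sub0r.
by apply: l2betti_group_sub => //; exact: l2betti_group_sub.
Qed.

Lemma l2betti_group_l2betti k (A : 'M[grpalg G]_k) : (0 < k)%N ->
  l2betti_group R G (l2betti R A).
Proof. by move=> k0 H [_ BH]; apply: BH; exists k, A. Qed.

End BettiGroup.

Theorem theorem1p1 (R : realType) (n : nat)
    (p : 'I_n.+1 -> {poly nat}) (d : 'I_n -> nat)
    (p_deg : forall l : 'I_n.+1, (2 <= size (p l))%N)
    (p0_lin : (1 <= ((p ord0)`_1)%R)%N)
    (d_ge2 : forall i : 'I_n, (2 <= d i)%N) :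
  (exists k0 : nat, exists A : 'M[grpalg lamplighter]_k0,
   exists q0 : rat, exists q1 : rat,
     [/\ (1 <= k0)%N,
         (forall i j : 'I_k0, algebra_half (A i j)),
         q0 != 0 /\ q1 != 0,
         l2betti R A = ratr q0 + ratr q1 * exponent_series R p d
       & l2betti_set R lamplighter
           (ratr q0 + ratr q1 * exponent_series R p d)])
  /\ ((p ord0)`_0 = 0%N ->
      l2betti_group R lamplighter (exponent_series R p d)).
Proof.
have [s [C [e [v Erec]]]] := linear_recurrent_exponent p d.
have E_lt := exponent_lt p0_lin d_ge2.
pose N k := (exponent p d k + 4)%N.
pose A := automaton_op (read0 C) (read1 e) (start v) (unit_coord s) (checks s).
have Nge k : (k <= N k)%N by apply: leq_trans (index_le E_lt k) (leq_addr _ _).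
have Nmono : {homo N : i j / (i <= j)%N}.
  move=> i j; rewrite leq_eqVlt => /orP[/eqP -> //|/E_lt/ltnW].
  by rewrite leq_add2r.
have lim := @automaton_l2betti R _ _ (read0 C) (read1 e) _ _ (checks s)
  (unit_coord_start v) N Nge Nmono.
pose S := exponent_series R p d.
have bE : l2betti R A = 2 + 2^-1 ^+ 6 * S.
  have massE k : ratr (accepted_mass (read0 C) (read1 e) (start v) (checks s) (N k)) =
      2^-1 ^+ 6 * \sum_(1 <= j < k.+1) (2 ^+ exponent p d j)^-1 :> R.
    rewrite (accepted_mass_code Erec E_lt) rmorph_sum mulr_sumr; apply: eq_bigr => j _.
    by rewrite rmorphXn fmorphV rmorph_nat addnC exprD exprVn exprVn.
  have c1 : ((fun k => \sum_(1 <= j < k.+1) (2 ^+ exponent p d j)^-1 : R) @ \oo -->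
      (2 ^+ 6 * (l2betti R A - 2 * 1)))%classic.
    rewrite (_ : (fun k => _) = fun k => 2 ^+ 6 *
       (ratr (accepted_mass (read0 C) (read1 e) (start v) (checks s) (N k)
          + 2%:R * block_mass (N k)) - 2 * ratr (block_mass (N k)))); last first.
      apply/funext => k; rewrite rmorphD rmorphM rmorph_nat /= addrK massE mulrA.
      by rewrite -exprMn divff // expr1n mul1r.
    apply: cvgMr; apply: cvgB; first exact: lim.
    by apply: cvgMr; exact: cvg_block_mass.
  have c2 : ((fun k => \sum_(1 <= j < k) (2 ^+ exponent p d j)^-1 : R) @ \oo -->
      (2 ^+ 6 * (l2betti R A - 2 * 1)))%classic by rewrite -cvg_shiftS.
  rewrite /S /exponent_series (cvg_lim _ c2) //.
  rewrite mulrA -exprMn mulVf // expr1n mul1r mulr1 addrC subrK //.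
split.
  exists (s + 3 + 2)%N, A, 2, (2^-1 ^+ 6).
  have e2 : ratr 2 + ratr (2^-1 ^+ 6) * S = l2betti R A.
    by rewrite bE rmorph_nat rmorphXn fmorphV rmorph_nat.
  split=> //.
  - by rewrite addnS.
  - by move=> i j; exact: automaton_op_in_algebra.
  by exists (s + 3 + 2)%N, A; split; [rewrite addnS|].
move=> _; have -> : exponent_series R p d = (l2betti R A - 2) *+ 64.
  by rewrite bE addrAC subrr add0r -/S -mulr_natl; field.
apply: l2betti_group_mulrn; apply: l2betti_group_sub.
  by apply: l2betti_group_l2betti; rewrite addnS.
by rewrite -(l2betti0 R lamplighter 2); exact: l2betti_group_l2betti.
Qed.
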